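(* Let $A=KQ/\langle Z\rangle$ be a folded gentle algebra, with repetitive algebra $A_R$ and with associated quiver $Q_R$ and set of relations $Z_R$ as defined in the context. Then $A_R\cong KQ_R/\langle Z_R\rangle$.
   Context: Paths in a quiver compose left to right: $\alpha_1\cdots\alpha_n$ is a path iff $t(\alpha_i)=s(\alpha_{i+1})$; $\varepsilon_v$ is the stationary path at $v$. Folded gentle triple $(K,Q,Z)$: $K$ is a field; $Q$ is a finite quiver with $Q_0=Q_0^{(1)}\sqcup Q_0^{(2)}$ (ordinary and crease vertices) and $Q_1=Q_1^{(1)}\sqcup Q_1^{(2)}$ (ordinary arrows and crease loops), where $Q_1^{(2)}=\{\eta_v : v\in Q_0^{(2)}\}$ with $\eta_v$ a loop at $v$; $Z=Z^{(1)}\sqcup Z^{(2)}\subseteq KQ$, where $Z^{(1)}$ is a set of paths of length at least $2$ in $Q\setminus Q_1^{(2)}$ (ordinary relations) and $Z^{(2)}=\{\eta_v^2-\lambda_{v,1}\eta_v-\lambda_{v,2}\varepsilon_v : v\in Q_0^{(2)}\}$ with $\lambda_{v,1},\lambda_{v,2}\in K$ (crease relations); such that: (FG1) every vertex is the source of at most two arrows and the target of at most two arrows; (FG2) for each $\beta\in Q_1^{(1)}$ there is at most one $\alpha\in Q_1$ with $\alpha\beta$ a path not in $Z^{(1)}$ and at most one $\gamma\in Q_1$ with $\beta\gamma$ a path not in $Z^{(1)}$; (FG3) for each $\beta\in Q_1^{(1)}$ there is at most one $\alpha\in Q_1$ with $\alpha\beta\in Z^{(1)}$ and at most one $\gamma\in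 Q_1$ with $\beta\gamma\in Z^{(1)}$; (FG4) all elements of $Z^{(1)}$ have length $2$; (FG5) each $x^2-\lambda_{v,1}x-\lambda_{v,2}$ is irreducible over $K$. It is assumed that $Q_0^{(2)}\neq\emptyset$ and that $A=KQ/\langle Z\rangle$ is finite-dimensional. Repetitive algebra: let $D=\operatorname{Hom}_K(-,K)$; $DA$ is an $A$-$A$-bimodule via $(af)(b)=f(ba)$, $(fa)(b)=f(ab)$. $A_R$ is the vector space of families $(a^{(i)},f^{(i)})_{i\in\mathbb Z}$ with $a^{(i)}\in A$, $f^{(i)}\in DA$, all but finitely many zero, with multiplication $(a^{(i)},f^{(i)})_i(b^{(i)},h^{(i)})_i=(a^{(i)}b^{(i)},\ a^{(i)}h^{(i)}+f^{(i)}b^{(i-1)})_i$. Quiver $Q_R$ and relations $Z_R$: let $\mathcal P_{Q,Z}$ be the set of paths of $Q$ (including stationary ones) containing no ordinary relation and no square of a crease loop as a subpath. A path in $\mathcal P_{Q,Z}$ is maximal if it has no non-trivial left or right concatenation in $\mathcal P_{Q,Z}$. $Q_R$ has vertices $v^{(i)}$ ($v\in Q_0$, $i\in\mathbb Z$), arrows $\alpha^{(i)}\colon s(\alpha)^{(i)}\to t(\alpha)^{(i)}$ ($\alpha\in Q_1$, $i\in\mathbb Z$), and connecting arrows $\chi_p^{(i)}\colon t(p)^{(i)}\to s(p)^{(i-1)}$ for each maximal path $p\in\mathcal P_{Q,Z}$ and $i\in\mathbb Z$. For a path $p$ in $Q$, $p^{(i)}$ is its $i$-th copy in $Q_R$.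 For a maximal path $p=p_1p_2$, the path $p_2^{(i)}\chi_p^{(i)}p_1^{(i-1)}$ is called a full path. $Z_R$ consists of (for all $i\in\mathbb Z$): (i) $\alpha^{(i)}\beta^{(i)}$ for each ordinary relation $\alpha\beta\in Z$; (ii) $(\eta_v^{(i)})^2-\lambda_{v,1}\eta_v^{(i)}-\lambda_{v,2}\varepsilon_v^{(i)}$ for each crease relation; (iii) the commutativity relations $p_3^{(i)}\chi_p^{(i)}p_1^{(i-1)}-q_3^{(i)}\chi_q^{(i)}q_1^{(i-1)}$ for any maximal paths $p=p_1p_2p_3$, $q=q_1q_2q_3$ in $\mathcal P_{Q,Z}$ with $p_2=q_2$; (iv) every other path of $Q_R$ that contains a connecting arrow and that is not, up to the commutativity relations and the crease relations, equivalent to a linear combination of subpaths of full paths.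
   Formalization: Relation (iv) of Z_R is imposed only on paths containing no square of a crease loop; imposed on all paths it would kill nonzero full paths (e.g. one arrow α into a crease vertex with η²=η+1 over F_2: αη²χ and αχ would both vanish, hence αηχ). *)

(* Defs.v *)
From HB Require Import structures.
From mathcomp Require Import all_boot all_algebra generic_quotient ring_quotient.
From mathcomp Require Import finmap boolp classical_sets functions.
From mathcomp.multinomials Require Import monalg.

Set Implicit Arguments.
Unset Strict Implicit.
Unset Printing Implicit Defensive.

Import GRing.Theory.

Local Open Scope ring_scope.
Local Open Scope quotient_scope.

(* The path algebra of an infinite quiver and the repetitive algebra have no
   unit, which excludes the ring hierarchy of ssralg. *)
HB.mixin Record Lmodule_isNUAlgebra (K : fieldType) V of GRing.Lmodule K V := {
  numul : V -> V -> V;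
  numulA : associative numul;
  numul_linearr : forall x : V, linear (numul x);
  numul_linearl : forall y : V, linear (numul^~ y)
}.

#[short(type="nualgType")]
HB.structure Definition NUAlgebra (K : fieldType) :=
  {V of GRing.Lmodule K V & Lmodule_isNUAlgebra K V}.

Notation "x ** y" := (numul x y) (at level 40, left associativity) : ring_scope.

Definition nualg_isomorphic (K : fieldType) (A B : nualgType K) : Prop :=
  exists f : A -> B, [/\ linear f, {morph f : x y / x ** y} & bijective f].

Definition finite_dimensional (K : fieldType) (V : lmodType K) : Prop :=
  exists n, inhabited (Vector.axiom n V).

Section NUAlgebraTheory.
Context {K : fieldType} {A : nualgType K}.
Implicit Types (x y : A) (c : K).

Lemma numulDr x : {morph numul x : y z / y + z}.
Proof. by move=> y z; have := numul_linearr x 1 y z; rewrite !scale1r. Qed.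

Lemma numulDl y : {morph numul^~ y : x z / x + z}.
Proof. by move=> x z; have := numul_linearl y 1 x z; rewrite !scale1r. Qed.

Lemma numulr0 x : x ** 0 = 0.
Proof. by apply: (addrI (x ** 0)); rewrite -numulDr !addr0. Qed.

Lemma numul0r x : 0 ** x = 0.
Proof. by apply: (addrI (0 ** x)); rewrite -numulDl !addr0. Qed.

Lemma numulZr c x y : x ** (c *: y) = c *: (x ** y).
Proof. by have := numul_linearr x c y 0; rewrite numulr0 !addr0. Qed.

Lemma numulZl c x y : (c *: x) ** y = c *: (x ** y).
Proof. by have := numul_linearl y c x 0; rewrite numul0r !addr0. Qed.

Lemma numulrB x y z : x ** (y - z) = x ** y - x ** z.
Proof. by rewrite numulDr -scaleN1r numulZr scaleN1r. Qed.

Lemma numulBr x y z : (x - y) ** z = x ** z - y ** z.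
Proof. by rewrite numulDl -scaleN1r numulZl scaleN1r. Qed.

End NUAlgebraTheory.

Section Ideal.
Context {K : fieldType} {A : nualgType K}.

Definition two_sided_ideal (I : set A) : Prop :=
  [/\ I 0, forall c x y, I x -> I y -> I (c *: x + y),
      forall a x, I x -> I (a ** x) & forall a x, I x -> I (x ** a)].

Definition ideal_gen (Z : set A) : set A :=
  [set x | forall I, two_sided_ideal I -> (Z `<=` I)%classic -> I x].

Lemma ideal_gen_ideal Z : two_sided_ideal (ideal_gen Z).
Proof.
split=> [I [? ? ? ?] _ //|c x y Ix Iy I hI ZI|a x Ix I hI ZI|a x Ix I hI ZI];
  have [_ IL Il Ir] := hI.
- by apply: IL; [apply: Ix|apply: Iy].
- by apply: Il; apply: Ix.
- by apply: Ir; apply: Ix.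
Qed.

Definition ideal_pred (Z : set A) : pred A := fun x => `[< ideal_gen Z x >].

Lemma ideal_predP Z x : reflect (ideal_gen Z x) (x \in ideal_pred Z).
Proof. exact: asboolP. Qed.

Lemma ideal_pred_closed Z : zmod_closed (ideal_pred Z).
Proof.
have [I0 IL _ _] := ideal_gen_ideal Z.
split=> [|x y /ideal_predP Ix /ideal_predP Iy]; apply/ideal_predP => //.
by rewrite addrC -scaleN1r; apply: IL.
Qed.

HB.instance Definition _ Z :=
  GRing.isZmodClosed.Build A (ideal_pred Z) (ideal_pred_closed Z).

Definition quotalg (Z : set A) :=
  Quotient.quot (GRing.ZmodClosed.clone A (ideal_pred Z) _).

HB.instance Definition _ Z := GRing.Zmodule.on (quotalg Z).

Section QuotientStructure.
Variable Z : set A.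
Local Notation Q := (quotalg Z).

Definition quot_proj (x : A) : Q := \pi_Q x.
Definition quot_repr (u : Q) : A := repr u.

Lemma quot_reprK : cancel quot_repr quot_proj.
Proof. exact: reprK. Qed.

Lemma quot_projE x y : quot_proj x = quot_proj y <-> ideal_gen Z (x - y).
Proof.
split=> [/eqP e|h].
  by apply/ideal_predP; rewrite Quotient.idealrBE.
by apply/eqP; rewrite -Quotient.idealrBE; apply/ideal_predP.
Qed.

Lemma quot_projD : {morph quot_proj : x y / x + y}.
Proof. by move=> x y; rewrite /quot_proj !piE. Qed.

Lemma quot_repr_proj x : ideal_gen Z (quot_repr (quot_proj x) - x).
Proof. by apply/quot_projE; rewrite quot_reprK. Qed.

Definition quot_scale (c : K) (u : Q) : Q := quot_proj (c *: quot_repr u).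

Lemma quot_scaleE c x : quot_scale c (quot_proj x) = quot_proj (c *: x).
Proof.
have [I0 IL _ _] := ideal_gen_ideal Z; apply/quot_projE.
by rewrite -scalerBr -[_ *: _]addr0; apply: IL => //; apply: quot_repr_proj.
Qed.

Fact quot_scalerA a b v :
  quot_scale a (quot_scale b v) = quot_scale (a * b) v.
Proof. by rewrite -[v]quot_reprK !quot_scaleE scalerA. Qed.

Fact quot_scale1r : left_id 1 quot_scale.
Proof. by move=> v; rewrite -[v]quot_reprK !quot_scaleE scale1r. Qed.

Fact quot_scalerDr : right_distributive quot_scale +%R.
Proof.
move=> a u v; rewrite -[u]quot_reprK -[v]quot_reprK.
by rewrite -quot_projD !quot_scaleE scalerDr quot_projD.
Qed.

Fact quot_scalerDl v : {morph quot_scale^~ v : a b / a + b}.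
Proof.
by move=> a b; rewrite -[v]quot_reprK !quot_scaleE scalerDl quot_projD.
Qed.

HB.instance Definition _ := GRing.Zmodule_isLmodule.Build K Q
  quot_scalerA quot_scale1r quot_scalerDr quot_scalerDl.

Definition quot_mul (u v : Q) : Q := quot_proj (quot_repr u ** quot_repr v).

Lemma quot_mulE x y : quot_mul (quot_proj x) (quot_proj y) = quot_proj (x ** y).
Proof.
have [_ IL Il Ir] := ideal_gen_ideal Z; apply/quot_projE.
set x' := quot_repr _; set y' := quot_repr _.
have -> : x' ** y' - x ** y = 1 *: ((x' - x) ** y') + x ** (y' - y).
  by rewrite scale1r numulBr numulrB addrA subrK.
by apply: IL; [apply: Ir|apply: Il]; apply: quot_repr_proj.
Qed.

Lemma quot_proj_linear : linear quot_proj.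
Proof. by move=> c x y; rewrite quot_projD -quot_scaleE. Qed.

Fact quot_mulA : associative quot_mul.
Proof.
move=> u v w; rewrite -[u]quot_reprK -[v]quot_reprK -[w]quot_reprK.
by rewrite !quot_mulE numulA.
Qed.

Fact quot_mul_linearr u : linear (quot_mul u).
Proof.
move=> c v w; rewrite -[u]quot_reprK -[v]quot_reprK -[w]quot_reprK.
by rewrite -quot_proj_linear !quot_mulE numul_linearr quot_proj_linear.
Qed.

Fact quot_mul_linearl v : linear (quot_mul^~ v).
Proof.
move=> c u w; rewrite -[u]quot_reprK -[v]quot_reprK -[w]quot_reprK.
by rewrite -quot_proj_linear !quot_mulE numul_linearl quot_proj_linear.
Qed.

HB.instance Definition _ :=
  Lmodule_isNUAlgebra.Build K Q quot_mulA quot_mul_linearr quot_mul_linearl.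

End QuotientStructure.
End Ideal.

Record quiver := Quiver {
  vert : choiceType;
  arr : choiceType;
  src : arr -> vert;
  tgt : arr -> vert
}.

Section Paths.
Variable Q : quiver.

Fixpoint composable (v : vert Q) (s : seq (arr Q)) : bool :=
  if s is a :: s' then (src a == v) && composable (tgt a) s' else true.

(* A path is given by its source and its sequence of arrows, read from left to
   right; the stationary path at v is (v, [::]). *)
Record qpath := QPath {
  pval : vert Q * seq (arr Q);
  _ : composable pval.1 pval.2
}.

HB.instance Definition _ := [isSub for pval].
HB.instance Definition _ := [Choice of qpath by <:].

Definition psrc (p : qpath) : vert Q := (pval p).1.
Definition parr (p : qpath) : seq (arr Q) := (pval p).2.
Definition ptgt (p : qpath) : vert Q := last (psrc p) (map (@tgt Q) (parr p)).

Definition stationary (v : vert Q) : qpath := @QPath (v, [::]) isT.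

Fact arrow_path_subproof a : composable (src a) [:: a].
Proof. by rewrite /= eqxx. Qed.
Definition arrow_path (a : arr Q) : qpath :=
  @QPath (src a, [:: a]) (arrow_path_subproof a).

Lemma composable_cat v s1 s2 : composable v (s1 ++ s2) =
  composable v s1 && composable (last v (map (@tgt Q) s1)) s2.
Proof. by elim: s1 v => //= a s1 IH v; rewrite IH andbA. Qed.

Fact pcat_subproof (p q : qpath) : ptgt p = psrc q ->
  composable (psrc p) (parr p ++ parr q).
Proof.
case: p q => [[v s] /= hp] [[w t] /= hq] e.
by rewrite composable_cat /= hp; move: e; rewrite /ptgt /psrc /parr /= => ->.
Qed.

Definition pcat (p q : qpath) : option qpath :=
  if @eqP _ (ptgt p) (psrc q) is ReflectT e
  then Some (@QPath (psrc p, parr p ++ parr q) (pcat_subproof e)) else None.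

Definition is_cat (p q r : qpath) : Prop := pcat p q = Some r.

Definition is_cat3 (p q r w : qpath) : Prop :=
  exists2 pq, is_cat p q pq & is_cat pq r w.

Definition subpath (q p : qpath) : Prop := exists u v, is_cat3 u q v p.

Lemma pcatP p q r : pcat p q = Some r <->
  [/\ ptgt p = psrc q, psrc r = psrc p & parr r = parr p ++ parr q].
Proof.
rewrite /pcat; case: eqP => [e|ne]; last by split=> [//|[]].
split=> [[<-]//|[_ e1 e2]]; congr Some; apply: val_inj => /=.
by rewrite -e1 -e2 /psrc /parr; case: (pval r).
Qed.

Lemma pcat_some p q : ptgt p = psrc q -> exists r, pcat p q = Some r.
Proof. by move=> e; rewrite /pcat; case: eqP => // e'; eexists. Qed.

Lemma pcat_None p q : pcat p q = None <-> ptgt p <> psrc q.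
Proof. by rewrite /pcat; case: eqP. Qed.

Lemma ptgt_cat p q r : pcat p q = Some r -> ptgt r = ptgt q.
Proof.
by move=> /pcatP[e1 e2 e3]; rewrite /ptgt e2 e3 map_cat last_cat -e1.
Qed.

Lemma pcatA p q r : obind (pcat p) (pcat q r) = obind (pcat^~ r) (pcat p q).
Proof.
case Eqr: (pcat q r) => [qr|] /=; case Epq: (pcat p q) => [pq|] //=.
- have /pcatP[a1 a2 a3] := Eqr; have /pcatP[b1 b2 b3] := Epq.
  have /pcat_some[d Ed] : ptgt p = psrc qr by rewrite a2.
  rewrite Ed; have /pcatP[_ d2 d3] := Ed.
  apply/esym/pcatP; split; first by rewrite (ptgt_cat Epq).
  - by rewrite d2 b2.
  - by rewrite d3 a3 b3 catA.
- have /pcatP[_ a2 _] := Eqr.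
  by apply/pcat_None; rewrite a2; apply/pcat_None.
- by apply/esym/pcat_None; rewrite (ptgt_cat Epq); apply/pcat_None.
Qed.

End Paths.

Definition pathalg (K : fieldType) (Q : quiver) : Type := {malg K[qpath Q]}.

Section PathAlgebra.
Variables (K : fieldType) (Q : quiver).
Local Notation KQ := (pathalg K Q).

HB.instance Definition _ := GRing.Lmodule.on KQ.

Definition pbasis (p : qpath Q) : KQ := << p >>.

Definition lin_ext (V : lmodType K) (h : qpath Q -> V) (f : KQ) : V :=
  \sum_(p <- msupp f) f@_p *: h p.

Lemma lin_ext_widen (V : lmodType K) (h : qpath Q -> V) f (d : {fset qpath Q}) :
  (msupp f `<=` d)%fset -> lin_ext h f = \sum_(p <- d) f@_p *: h p.
Proof.
move=> le; rewrite /lin_ext (big_fset_incl _ le) //= => p _ /mcoeff_outdom ->.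
by rewrite scale0r.
Qed.

Lemma lin_ext_linear (V : lmodType K) (h : qpath Q -> V) : linear (lin_ext h).
Proof.
move=> c f g; pose d := (msupp f `|` msupp g `|` msupp (c *: f + g))%fset.
rewrite !(@lin_ext_widen _ h _ d).
- rewrite scaler_sumr -big_split /=; apply: eq_bigr => p _.
  by rewrite mcoeffD mcoeffZ scalerDl scalerA.
- by rewrite /d -fsetUA fsetUCA fsubsetUl.
- by rewrite /d -fsetUA fsubsetUl.
- by rewrite /d fsubsetUr.
Qed.

Lemma lin_extU (V : lmodType K) (h : qpath Q -> V) p :
  lin_ext h (pbasis p) = h p.
Proof.
rewrite (@lin_ext_widen _ h _ [fset p]%fset) ?msuppU_le //.
by rewrite big_seq_fset1 mcoeffUU scale1r.
Qed.

Lemma pathalgE (f : KQ) : f = lin_ext pbasis f.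
Proof.
rewrite {1}[f]monalgE; apply: eq_bigr => p _.
by apply/malgP => q; rewrite mcoeffZ !mcoeffU mulr_natr.
Qed.

Lemma linear_lin_ext (V : lmodType K) (F : KQ -> V) : linear F ->
  forall f, F f = lin_ext (F \o pbasis) f.
Proof.
move=> linF f; rewrite {1}[f]pathalgE /lin_ext.
pose G : {linear KQ -> V} := HB.pack F (GRing.isLinear.Build _ _ _ _ F linF).
by rewrite -[F]/(G : _ -> _) linear_sum; apply: eq_bigr => p _; rewrite linearZ.
Qed.

Lemma eq_linear_pbasis (V : lmodType K) (F G : KQ -> V) : linear F -> linear G ->
  (forall p, F (pbasis p) = G (pbasis p)) -> forall f, F f = G f.
Proof.
move=> lF lG e f; rewrite (linear_lin_ext lF) (linear_lin_ext lG).
by apply: eq_bigr => p _; rewrite /= e.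
Qed.

Definition basis_mul (p q : qpath Q) : KQ :=
  if pcat p q is Some r then pbasis r else 0.

Definition path_mul (f g : KQ) : KQ :=
  lin_ext (fun p => lin_ext (basis_mul p) g) f.

Lemma path_mul_basis p q : path_mul (pbasis p) (pbasis q) = basis_mul p q.
Proof. by rewrite /path_mul !lin_extU. Qed.

Fact path_mul_linearl g : linear (path_mul^~ g).
Proof. exact: lin_ext_linear. Qed.

Fact path_mul_linearr f : linear (path_mul f).
Proof.
move=> c g h; rewrite /path_mul {1 3 5}/lin_ext scaler_sumr -big_split /=.
apply: eq_bigr => p _; rewrite lin_ext_linear.
by rewrite scalerDr !scalerA mulrC.
Qed.

Fact path_mulA : associative path_mul.
Proof.
have comp (V1 V2 V3 : lmodType K) (F : V2 -> V3) (G : V1 -> V2) :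
  linear F -> linear G -> linear (F \o G) by move=> lF lG a x y /=; rewrite lG lF.
have b0l q : path_mul 0 q = 0 by rewrite /path_mul /lin_ext msupp0 big_seq_fset0.
have b0r p : path_mul (pbasis p) 0 = 0.
  by rewrite /path_mul lin_extU /lin_ext msupp0 big_seq_fset0.
move=> x y z.
apply: (eq_linear_pbasis (F := path_mul^~ (path_mul y z))
  (G := path_mul^~ z \o path_mul^~ y)) x => [||p /=].
- exact: path_mul_linearl.
- by apply: comp; apply: path_mul_linearl.
apply: (eq_linear_pbasis (F := path_mul (pbasis p) \o path_mul^~ z)
  (G := path_mul^~ z \o path_mul (pbasis p))) y => [||q /=].
- by apply: comp; [apply: path_mul_linearr|apply: path_mul_linearl].
- by apply: comp; [apply: path_mul_linearl|apply: path_mul_linearr].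
apply: (eq_linear_pbasis (F := path_mul (pbasis p) \o path_mul (pbasis q))
  (G := path_mul (path_mul (pbasis p) (pbasis q)))) z => [||r /=].
- by apply: comp; apply: path_mul_linearr.
- exact: path_mul_linearr.
rewrite (path_mul_basis q r) (path_mul_basis p q) /basis_mul.
have := pcatA p q r.
case: (pcat q r) => [qr|]; case: (pcat p q) => [pq|] /= => e.
- by rewrite (path_mul_basis p qr) (path_mul_basis pq r) /basis_mul e.
- by rewrite b0l (path_mul_basis p qr) /basis_mul e.
- by rewrite b0r (path_mul_basis pq r) /basis_mul -e.
- by rewrite b0l b0r.
Qed.

HB.instance Definition _ := Lmodule_isNUAlgebra.Build K KQ
  path_mulA path_mul_linearr path_mul_linearl.

End PathAlgebra.

Section Dual.
Variables (K : fieldType) (A : nualgType K).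

Definition scalar_pred : pred (A -> K^o) := fun f => `[< scalar f >].

Record dual := Dual { dual_fun :> A -> K^o; _ : scalar_pred dual_fun }.

HB.instance Definition _ := [isSub for dual_fun].
HB.instance Definition _ := [Choice of dual by <:].

Fact scalar_pred_closed : submod_closed scalar_pred.
Proof.
split=> [|c f g /asboolP lf /asboolP lg]; apply/asboolP => a x y.
  by rewrite /= mulr0 addr0.
rewrite /GRing.add /GRing.scale /= lf lg /GRing.scale /=.
by rewrite !mulrDr !mulrA [c * a]mulrC addrACA.
Qed.

HB.instance Definition _ := GRing.isSubmodClosed.Build K (A -> K^o)
  scalar_pred scalar_pred_closed.
HB.instance Definition _ := [SubChoice_isSubLmodule of dual by <:].

Lemma dual_scalar (f : dual) : scalar f.
Proof. by case: f => f /= /asboolP. Qed.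

Fact dual_lact_subproof (a : A) (f : dual) : scalar_pred (fun b => f (b ** a)).
Proof.
by apply/asboolP => c x y; rewrite numul_linearl dual_scalar.
Qed.

Fact dual_ract_subproof (f : dual) (a : A) : scalar_pred (fun b => f (a ** b)).
Proof.
by apply/asboolP => c x y; rewrite numul_linearr dual_scalar.
Qed.

Definition dual_lact (a : A) (f : dual) : dual := Dual (dual_lact_subproof a f).
Definition dual_ract (f : dual) (a : A) : dual := Dual (dual_ract_subproof f a).

Implicit Types (a b : A) (f g : dual) (c : K).

Lemma dual_lactE a f b : dual_lact a f b = f (b ** a) :> K.
Proof. by []. Qed.

Lemma dual_ractE f a b : dual_ract f a b = f (a ** b) :> K.
Proof. by []. Qed.

Lemma dualP f g : (forall b, f b = g b) -> f = g.
Proof. by move=> e; apply: val_inj; apply: funext. Qed.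

Lemma dualDE f g b : (f + g) b = f b + g b.
Proof. by []. Qed.

Lemma dualZE c f b : (c *: f) b = c * f b.
Proof. by []. Qed.

Lemma dual0E b : (0 : dual) b = 0.
Proof. by []. Qed.

Lemma dual_f0 f : f 0 = 0.
Proof. by have := dual_scalar f (-1) 0 0; rewrite scaler0 addr0 mulN1r addNr. Qed.

End Dual.

(* {malg V[int]} is the type of finitely supported families int -> V. *)
Definition repalg (K : fieldType) (A : nualgType K) : Type :=
  {malg (A * dual A)%type[int]}.

Section Repetitive.
Variables (K : fieldType) (A : nualgType K).
Local Notation AR := (repalg A).
Implicit Types (x y z : AR) (c : K).

HB.instance Definition _ := GRing.Zmodule.on AR.

Definition rep_scale (c : K) (x : AR) : AR :=
  [malg i in msupp x => c *: x@_i].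

Definition rep_mul (x y : AR) : AR :=
  [malg i in msupp x =>
    ((x@_i).1 ** (y@_i).1,
     dual_lact (x@_i).1 (y@_i).2 + dual_ract (x@_i).2 (y@_(i - 1)).1)].

Lemma rep_scaleE c x i : (rep_scale c x)@_i = c *: x@_i.
Proof. by rewrite mcoeffE; case: msuppP => // _; rewrite scaler0. Qed.

Lemma rep_mulE x y i : (rep_mul x y)@_i =
  ((x@_i).1 ** (y@_i).1, dual_lact (x@_i).1 (y@_i).2 + dual_ract (x@_i).2 (y@_(i - 1)).1).
Proof.
rewrite mcoeffE; case: msuppP => // _; congr pair => /=.
  by rewrite numul0r.
by apply: dualP => b; rewrite dualDE dual_lactE dual_ractE numulr0 dual_f0 addr0.
Qed.

Fact rep_scalerA (a b : K) x : rep_scale a (rep_scale b x) = rep_scale (a * b) x.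
Proof. by apply/malgP => i; rewrite !rep_scaleE scalerA. Qed.

Fact rep_scale1r : left_id 1 rep_scale.
Proof. by move=> x; apply/malgP => i; rewrite rep_scaleE scale1r. Qed.

Fact rep_scalerDr : right_distributive rep_scale +%R.
Proof.
by move=> c x y; apply/malgP => i; rewrite !(mcoeffD, rep_scaleE) scalerDr.
Qed.

Fact rep_scalerDl x : {morph rep_scale^~ x : a b / a + b}.
Proof.
by move=> a b; apply/malgP => i; rewrite !(mcoeffD, rep_scaleE) scalerDl.
Qed.

HB.instance Definition _ := GRing.Zmodule_isLmodule.Build K AR
  rep_scalerA rep_scale1r rep_scalerDr rep_scalerDl.

Fact rep_mulA : associative rep_mul.
Proof.
move=> x y z; apply/malgP => i; rewrite !rep_mulE /= numulA; congr pair.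
apply: dualP => b.
rewrite !(dualDE, dual_lactE, dual_ractE) !numulA.
by rewrite addrA.
Qed.

Fact rep_mul_linearr x : linear (rep_mul x).
Proof.
move=> c y z; apply/malgP => i; rewrite !(rep_mulE, mcoeffD, rep_scaleE).
congr pair => /=; first by rewrite numul_linearr.
apply: dualP => b.
rewrite !(dualDE, dualZE, dual_lactE, dual_ractE) numul_linearl dual_scalar.
by rewrite mulrDr addrACA.
Qed.

Fact rep_mul_linearl y : linear (rep_mul^~ y).
Proof.
move=> c x z; apply/malgP => i; rewrite !(rep_mulE, mcoeffD, rep_scaleE).
congr pair => /=; first by rewrite numul_linearl.
apply: dualP => b.
rewrite !(dualDE, dualZE, dual_lactE, dual_ractE) numul_linearr dual_scalar.
by rewrite mulrDr addrACA.
Qed.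

HB.instance Definition _ := Lmodule_isNUAlgebra.Build K AR
  rep_mulA rep_mul_linearr rep_mul_linearl.

End Repetitive.

(* Crease vertices index the crease loops, so the arrows of the quiver are the
   ordinary arrows together with one loop at each crease vertex. *)
Record folded_quiver := FoldedQuiver {
  overt : finType;
  cvert : finType;
  oarr : finType;
  osrc : oarr -> overt + cvert;
  otgt : oarr -> overt + cvert
}.

Section FoldedQuiver.
Variable F : folded_quiver.

Definition fvert : finType := (overt F + cvert F)%type.
Definition farr : finType := (oarr F + cvert F)%type.

Definition fsrc (a : farr) : fvert :=
  match a with inl b => osrc b | inr v => inr v end.
Definition ftgt (a : farr) : fvert :=
  match a with inl b => otgt b | inr v => inr v end.

Definition fquiver : quiver := @Quiver fvert farr fsrc ftgt.

Definition ordinary (b : oarr F) : arr fquiver := inl b.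
Definition crease_loop (v : cvert F) : arr fquiver := inr v.
Definition crease_vertex (v : cvert F) : vert fquiver := inr v.

Definition is_ordinary (a : arr fquiver) : bool :=
  if a is inl _ then true else false.

End FoldedQuiver.

Record folded_triple (K : fieldType) := FoldedTriple {
  folded_quiver_of :> folded_quiver;
  ord_rel : set (qpath (fquiver folded_quiver_of));
  lam1 : cvert folded_quiver_of -> K;
  lam2 : cvert folded_quiver_of -> K
}.

Arguments ord_rel {K} _.
Arguments lam1 {K} _.
Arguments lam2 {K} _.

Section FoldedGentle.
Variables (K : fieldType) (T : folded_triple K).
Local Notation Q := (fquiver T).

Record folded_gentle : Prop := FoldedGentle {
  fg_ord_rel : forall z, ord_rel T z ->
    (2 <= size (parr z))%N /\ all (@is_ordinary T) (parr z);
  fg1_src : forall v : fvert T, (#|[set a : farr T | fsrc a == v]%SET| <= 2)%N;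
  fg1_tgt : forall v : fvert T, (#|[set a : farr T | ftgt a == v]%SET| <= 2)%N;
  fg2_left : forall b : oarr T,
    is_subset1 [set a | exists2 p : qpath Q,
      parr p = [:: a; ordinary b] & ~ ord_rel T p];
  fg2_right : forall b : oarr T,
    is_subset1 [set c | exists2 p : qpath Q,
      parr p = [:: ordinary b; c] & ~ ord_rel T p];
  fg3_left : forall b : oarr T,
    is_subset1 [set a | exists2 p : qpath Q,
      parr p = [:: a; ordinary b] & ord_rel T p];
  fg3_right : forall b : oarr T,
    is_subset1 [set c | exists2 p : qpath Q,
      parr p = [:: ordinary b; c] & ord_rel T p];
  fg4 : forall z, ord_rel T z -> size (parr z) = 2%N;
  fg5 : forall v : cvert T,
    irreducible_poly ('X^2 - lam1 T v *: 'X - (lam2 T v)%:P : {poly K})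
}.

Definition crease_rel (v : cvert T) : pathalg K Q :=
  let eta := pbasis K (arrow_path (crease_loop v)) in
  eta ** eta - lam1 T v *: eta - lam2 T v *: pbasis K (stationary (crease_vertex v)).

Definition relations : set (pathalg K Q) :=
  ([set pbasis K z | z in ord_rel T] `|` range crease_rel)%classic.

Definition folded_algebra : nualgType K := quotalg relations.

Definition crease_square (q : qpath Q) : Prop :=
  exists v : cvert T, parr q = [:: crease_loop v; crease_loop v].

Definition reduced_path : set (qpath Q) :=
  [set p | forall q, subpath q p -> ~ ord_rel T q /\ ~ crease_square q]%classic.

Definition maximal_path (p : qpath Q) : Prop :=
  reduced_path p /\
  forall q r, parr q != [::] -> is_cat q p r \/ is_cat p q r -> ~ reduced_path r.

Definition maximal_pred : pred (qpath Q) := fun p => `[< maximal_path p >].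

Record maxpath := MaxPath {
  mpath :> qpath Q;
  _ : maximal_pred mpath
}.

HB.instance Definition _ := [isSub for mpath].
HB.instance Definition _ := [Choice of maxpath by <:].

Definition rvert : choiceType := (vert Q * int)%type.
Definition rarr : choiceType := (arr Q * int + maxpath * int)%type.

Definition rsrc (a : rarr) : rvert :=
  match a with
  | inl (b, i) => (src b, i)
  | inr (p, i) => (ptgt p, i)
  end.
Definition rtgt (a : rarr) : rvert :=
  match a with
  | inl (b, i) => (tgt b, i)
  | inr (p, i) => (psrc p, i - 1)
  end.

Definition rquiver : quiver := @Quiver rvert rarr rsrc rtgt.
Local Notation QR := rquiver.

Definition copy_arr (i : int) (a : arr Q) : arr QR := inl (a, i).
Definition chi (p : maxpath) (i : int) : arr QR := inr (p, i).
Definition is_connecting (a : arr QR) : bool := if a is inr _ then true else false.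

Fact copy_subproof i (p : qpath Q) :
  @composable QR (psrc p, i) (map (copy_arr i) (parr p)).
Proof.
case: p => [[v s]] /=; rewrite /psrc /parr /=.
by elim: s v => //= a s IH v /andP[/eqP -> /IH ->]; rewrite eqxx.
Qed.

Definition copy (i : int) (p : qpath Q) : qpath QR :=
  @QPath QR ((psrc p, i), map (copy_arr i) (parr p)) (copy_subproof i p).

Definition around (p3 : qpath Q) (p : maxpath) (p1 : qpath Q) (i : int)
    (w : qpath QR) : Prop :=
  is_cat3 (copy i p3) (arrow_path (chi p i)) (copy (i - 1) p1) w.

Definition full_path (w : qpath QR) : Prop :=
  exists (p : maxpath) p1 p2 i, is_cat p1 p2 p /\ around p2 p p1 i w.

Definition full_subpath (w : qpath QR) : Prop :=
  exists2 f, full_path f & subpath w f.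

Definition rep_ord_rels : set (pathalg K QR) :=
  [set x | exists z i, ord_rel T z /\ x = pbasis K (copy i z)]%classic.

Definition rep_crease_rel (v : cvert T) (i : int) : pathalg K QR :=
  let eta := pbasis K (arrow_path (copy_arr i (crease_loop v))) in
  eta ** eta - lam1 T v *: eta
  - lam2 T v *: pbasis K (copy i (stationary (crease_vertex v))).

Definition rep_crease_rels : set (pathalg K QR) :=
  [set x | exists v i, x = rep_crease_rel v i]%classic.

Definition rep_comm_rels : set (pathalg K QR) :=
  [set x | exists (p q : maxpath) p1 q1 m p3 q3 i w w',
     [/\ is_cat3 p1 m p3 p, is_cat3 q1 m q3 q, around p3 p p1 i w,
         around q3 q q1 i w' & x = pbasis K w - pbasis K w']]%classic.

Definition rep_crease_square (q : qpath QR) : Prop :=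
  exists (v : cvert T) i,
    parr q = [:: copy_arr i (crease_loop v); copy_arr i (crease_loop v)].

(* Paths are taken up to the crease relations, hence in their form without
   squares of crease loops; the other paths are rewritten by [rep_crease_rels].
   Without that condition a path would be declared zero as soon as one of the
   terms it rewrites to is not a subpath of a full path.  For instance, if alpha
   is an ordinary arrow into a crease vertex with loop eta and there are no other
   arrows, then p = alpha eta is maximal, and in the quotient
     alpha eta^2 chi_p = lam1 alpha eta chi_p + lam2 alpha chi_p,
   where alpha chi_p = 0, whereas the full path alpha eta chi_p is not 0. *)
Definition zero_path (w : qpath QR) : Prop :=
  [/\ has is_connecting (parr w),
      (forall q, subpath q w -> ~ rep_crease_square q) &
      ~ exists y : pathalg K QR, (forall q, q \in msupp y -> full_subpath q) /\
          ideal_gen (rep_crease_rels `|` rep_comm_rels)%classic (pbasis K w - y)].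

Definition rep_zero_rels : set (pathalg K QR) :=
  [set pbasis K w | w in zero_path]%classic.

Definition rep_relations : set (pathalg K QR) :=
  (rep_ord_rels `|` rep_crease_rels `|` rep_comm_rels `|` rep_zero_rels)%classic.

End FoldedGentle.

Arguments relations {K} T _.
Arguments rep_relations {K} T _.

(* Main.v *)
From HB Require Import structures.
Require Import Defs.
From mathcomp Require Import all_boot all_algebra.
From mathcomp Require Import finmap boolp classical_sets.
From mathcomp.multinomials Require Import monalg.
From mathcomp Require Import ring.

(** Let p^* be the form on A that reads off the coefficient of a maximal path p.
    The homomorphism [rep_hom] from K Q_R to A_R sends an arrow alpha^(i) to alpha in
    the i-th copy of A, and chi_p^(i) to p^* in the i-th copy of DA.  It kills the
    relations of Q_R, and the map [rep_map] that it induces on the quotient has an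
    explicit linear inverse [rep_inv].

    The forms p^* are obtained without a basis of A.  The arrows act from the right
    on the space spanned by the prefixes of p, and p^* is the coefficient of p in the
    image of the empty prefix ([coef], [top_form]).  A reduced path runs through a
    crease vertex along its loop, and a maximal path does so also at its ends
    ([saturated]); this is why the action satisfies the crease relations
    ([coef_crease]), and the ordinary ones hold because p is reduced ([coef_ord]).
    A word moves ahead by at most one prefix per letter, so a word that is not longer
    than p has coefficient 1 if it is p and 0 otherwise ([coef_size]).  Hence
    saturated paths of distinct lengths are linearly independent, and since A is
    finite-dimensional the lengths of reduced paths are bounded ([reduced_bounded]):
    there are finitely many, and each of them is part of a maximal path
    ([maximal_extension]).  For a reduced path m choose p = p1 m p3; the matrix of
    values of the forms p3 p^* p1 on reduced paths is unitriangular ([gram_unit]),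
    so that these forms are a basis of DA.

    In the repetitive algebra p3 chi_p p1 becomes p3 p^* p1.  For the commutativity
    relations one needs that this form depends only on m ([top_form_comm]).  If m is
    not stationary, then the gentle conditions determine p, p1 and p3.  If m is the
    stationary path at v, counting ordinary arrows shows that the form vanishes on
    all paths but m and, if v is a crease vertex, the powers of the loop at v, and on
    these the crease relation fixes its values.  For the zero relations, q p^* r can only be nonzero if r is a
    beginning and q is an end of p and the two are disjoint or overlap in one crease
    loop ([top_form_neq0]).  In the first case q chi_p r is a subpath of a full path;
    in the second it is a combination of such subpaths modulo the crease and
    commutativity relations ([overlap_full]).  So the other paths go to 0.

    The inverse [rep_inv] copies A into each level and sends the basis element
    p3 p^* p1 of the i-th copy of DA to the class of p3 chi_p^(i) p1.  Then [rep_map]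
    after [rep_inv] is the identity by construction ([rep_invK]), and [rep_inv] is
    onto because the relations reduce every path of Q_R to a combination of copies of
    paths of Q and of subpaths of full paths, one for each m ([in_image_path]). *)

Set Implicit Arguments.
Unset Strict Implicit.
Unset Printing Implicit Defensive.

Import GRing.Theory.

Local Open Scope ring_scope.

#[local] Opaque pbasis path_mul lin_ext.

(** * Ideals and quotients of non-unital algebras *)

Section LinearInstances.
Variables (K : fieldType).

HB.instance Definition _ (A : nualgType K) (x : A) :=
  GRing.isLinear.Build K A A *:%R (numul x) (numul_linearr x).

HB.instance Definition _ (A : nualgType K) (Z : set A) :=
  GRing.isLinear.Build K A (quotalg Z) *:%R (@quot_proj K A Z) (@quot_proj_linear K A Z).

HB.instance Definition _ (Q : quiver) (V : lmodType K) (h : qpath Q -> V) :=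
  GRing.isLinear.Build K (pathalg K Q) V *:%R (lin_ext h) (lin_ext_linear h).

End LinearInstances.

Lemma quadratic_distr (K : fieldType) (A : nualgType K) (u v e s : A) c1 c2 :
  u ** (e ** e - c1 *: e - c2 *: s) ** v =
  u ** (e ** e) ** v - c1 *: (u ** e ** v) - c2 *: (u ** s ** v).
Proof. by rewrite !numulrB !numulBr !numulZr !numulZl. Qed.

Lemma quadratic_zero (K : fieldType) (A : nualgType K) (u v e s : A) c1 c2 :
  s ** e = e -> e ** s = e -> s ** s = s -> u ** s = 0 \/ s ** v = 0 ->
  u ** (e ** e - c1 *: e - c2 *: s) ** v = 0.
Proof.
move=> se es ss [us|sv]; rewrite quadratic_distr.
  by rewrite -[in u ** s]ss -se !numulA us !numul0r !scaler0 !subr0.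
by rewrite -es -!numulA -[in c2 *: _]ss -!numulA sv !numulr0 !scaler0 !subr0.
Qed.

Lemma numul3_eq0 (K : fieldType) (A : nualgType K) (x y z : A) :
  x ** y = 0 \/ y ** z = 0 -> x ** y ** z = 0.
Proof. by case=> e; [rewrite e numul0r|rewrite -numulA e numulr0]. Qed.

Section Ideals.
Variables (K : fieldType) (A : nualgType K).
Implicit Types (Z I : set A).

Lemma quot_proj_eq0 Z x : quot_proj Z x = 0 <-> ideal_gen Z x.
Proof. by rewrite -[0](linear0 (quot_proj Z)) quot_projE subr0. Qed.

Lemma quot_projM Z x y :
  quot_proj Z (x ** y) = quot_proj Z x ** quot_proj Z y.
Proof. exact: esym (quot_mulE Z x y). Qed.

Lemma quot_projM3 Z x y z :
  quot_proj Z (x ** y ** z) = quot_proj Z x ** quot_proj Z y ** quot_proj Z z.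
Proof. by rewrite !quot_projM. Qed.

Lemma ideal_gen_subrr Z x : ideal_gen Z (x - x).
Proof. by rewrite subrr; case: (ideal_gen_ideal Z). Qed.

Lemma ideal_genS Z x : Z x -> ideal_gen Z x.
Proof. by move=> Zx I _; apply. Qed.

Lemma ideal_gen_mono Z Z' x : (Z `<=` Z')%classic -> ideal_gen Z x -> ideal_gen Z' x.
Proof. by move=> sZ Zx I hI ZI; apply: Zx => // y /sZ /ZI. Qed.

(** The map induced on a quotient is L \o quot_repr; the two lemmas below say that
    it does not depend on the chosen representatives. *)
Lemma quot_liftE (V : lmodType K) (L : {linear A -> V}) Z :
  (forall x, ideal_gen Z x -> L x = 0) ->
  forall x, L (quot_repr (quot_proj Z x)) = L x.
Proof.
move=> L0 x; apply/eqP; rewrite -subr_eq0 -linearB; apply/eqP; apply: L0.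
exact: quot_repr_proj.
Qed.

Lemma quot_lift_linear (V : lmodType K) (L : {linear A -> V}) Z :
  (forall x, ideal_gen Z x -> L x = 0) ->
  linear (fun u : quotalg Z => L (quot_repr u)).
Proof.
move=> L0 c u v; rewrite -[u]quot_reprK -[v]quot_reprK -linearP.
by rewrite !quot_liftE // linearP.
Qed.

Lemma ideal_preim (B : nualgType K) (h : {linear A -> B}) (J : set B) :
  {morph h : x y / x ** y} -> two_sided_ideal J ->
  two_sided_ideal (h @^-1` J)%classic.
Proof.
move=> hM [J0 JL Jl Jr]; split=> [|c x y|a x|a x] /=.
- by rewrite linear0.
- by rewrite linearP; apply: JL.
- by rewrite hM; apply: Jl.
- by rewrite hM; apply: Jr.
Qed.

Lemma ideal_zero : two_sided_ideal [set 0 : A]%classic.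
Proof.
split=> [//|c x y -> ->|a x ->|a x ->] /=.
- by rewrite scaler0 addr0.
- by rewrite numulr0.
- by rewrite numul0r.
Qed.

End Ideals.

Section Multilinear.
Variables (K : fieldType) (A : nualgType K) (V : lmodType K) (L : {linear A -> V}).
Implicit Types (x y z : A).

Lemma sum_unitl (I : finType) (F : I -> A) i x :
  F i ** x = x -> (forall j, j != i -> F j ** x = 0) -> (\sum_j F j) ** x = x.
Proof.
move=> Fi Fj; rewrite (big_morph (numul^~ x) (numulDl x) (numul0r x)).
by rewrite (bigD1 i) //= Fi big1 // addr0.
Qed.

Lemma sum_unitr (I : finType) (F : I -> A) i x :
  x ** F i = x -> (forall j, j != i -> x ** F j = 0) -> x ** (\sum_j F j) = x.
Proof.
move=> Fi Fj; rewrite (big_morph (numul x) (numulDr x) (numulr0 x)).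
by rewrite (bigD1 i) //= Fi big1 // addr0.
Qed.

Lemma linear_quadratic (c d : K) x y z :
  L (x - c *: y - d *: z) = L x - c *: L y - d *: L z.
Proof. by rewrite !linearB !linearZ. Qed.

Lemma linear_mull x z : linear (fun y => L (y ** x ** z)).
Proof. by move=> c y1 y2; rewrite !numul_linearl linearP. Qed.

Lemma linear_mulm y z : linear (fun x => L (y ** x ** z)).
Proof. by move=> c x1 x2; rewrite numul_linearr numul_linearl linearP. Qed.

Lemma linear_mulr y x : linear (fun z => L (y ** x ** z)).
Proof. by move=> c z1 z2; rewrite !numul_linearr linearP. Qed.

Lemma linear_cst0 : linear (fun _ : A => 0 : V).
Proof. by move=> c x y; rewrite scaler0 addr0. Qed.

(** Taking the sandwiches y ** x ** z into the condition turns the kernel of a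
    single linear map into an ideal. *)
Lemma sandwich_ideal : two_sided_ideal [set x | forall y z, L (y ** x ** z) = 0]%classic.
Proof.
split=> [y z|c x1 x2 h1 h2 y z|y x1 h1 y' z|y x1 h1 y' z] /=.
- by rewrite numulr0 numul0r linear0.
- by rewrite numul_linearr numul_linearl linearP h1 h2 scaler0 addr0.
- by rewrite numulA h1.
- by rewrite numulA -numulA h1.
Qed.

End Multilinear.

Lemma quot_proj_combination (K : fieldType) (A : nualgType K) (Z : set A) x y z c d :
  ideal_gen Z (x - c *: y - d *: z) ->
  quot_proj Z x = c *: quot_proj Z y + d *: quot_proj Z z.
Proof.
move/quot_proj_eq0 => I; apply/eqP; rewrite -subr_eq0 opprD addrA.
by apply/eqP; apply: etrans (esym (linear_quadratic (quot_proj Z) _ _ _ _ _)) I.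
Qed.

Lemma can2_numul (K : fieldType) (A B : nualgType K) (f : A -> B) (h : B -> A) :
  cancel f h -> cancel h f -> {morph h : u v / u ** v} -> {morph f : x y / x ** y}.
Proof. by move=> fK hK hM x y; apply: (can_inj hK); rewrite hM !fK. Qed.

Section CommonImage.
Variables (K : fieldType) (U V W : lmodType K) (f : {linear U -> W}) (h : {linear V -> W}).

Lemma image_add a b a' b' : f a' = h a -> f b' = h b -> f (a' + b') = h (a + b).
Proof. by move=> ea eb; rewrite !linearD ea eb. Qed.

Lemma image_scale c a a' : f a' = h a -> f (c *: a') = h (c *: a).
Proof. by move=> ea; rewrite !linearZ ea. Qed.

End CommonImage.

Section Forms.
Variables (K : fieldType) (A : nualgType K).

Lemma dual_combination (h : dual A) (c d : K) x y z :
  x = c *: y + d *: z -> h x = c * h y + d * h z.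
Proof.
move=> ->; rewrite dual_scalar; congr (_ + _).
by have := dual_scalar h d z 0; rewrite !addr0 dual_f0 addr0.
Qed.

Lemma dual_sumE n (c : 'I_n -> K) (g : 'I_n -> dual A) x :
  (\sum_k c k *: g k) x = \sum_k c k * g k x.
Proof. by rewrite (big_morph (fun f : dual A => f x) (id1 := 0) (op1 := +%R)). Qed.

Lemma dual_quot (Z : set A) (L : {linear A -> K^o}) :
  (forall x, ideal_gen Z x -> L x = 0) ->
  exists d : dual (quotalg Z), forall x, d (quot_proj Z x) = L x.
Proof.
move=> L0; have sf : scalar_pred (fun u : quotalg Z => L (quot_repr u)).
  by apply/asboolP => c u v; apply: (quot_lift_linear L0).
by exists (Dual sf) => x; apply: quot_liftE.
Qed.

End Forms.

(** * Paths and the path algebra *)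

Section PathLemmas.
Variable Q : quiver.
Implicit Types (p q r w : qpath Q) (a : arr Q) (s : seq (arr Q)).

Lemma composableP p : composable (psrc p) (parr p).
Proof. by case: p. Qed.

Lemma qpath_eq p q : psrc p = psrc q -> parr p = parr q -> p = q.
Proof.
case: p q => [[v s] hp] [[w t] hq]; rewrite /psrc /parr /= => e1 e2.
by apply: val_inj; rewrite /= e1 e2.
Qed.

Lemma qpath_eq_tgt p q : ptgt p = ptgt q -> parr p = parr q -> p = q.
Proof.
move=> et e; apply: qpath_eq => //.
move: (composableP p) (composableP q) et; rewrite /ptgt -e.
by case: (parr p) => [//|a s] /= /andP[/eqP<- _] /andP[/eqP<- _].
Qed.

Lemma ptgt_stationary (v : vert Q) : ptgt (stationary v) = v. Proof. by []. Qed.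

Lemma ptgt_arrow a : ptgt (arrow_path a) = tgt a. Proof. by []. Qed.

Lemma parr_nil p : parr p = [::] -> p = stationary (psrc p).
Proof. by move=> e; apply: qpath_eq. Qed.

Lemma is_cat_fun p q r r' : is_cat p q r -> is_cat p q r' -> r = r'.
Proof. by rewrite /is_cat => -> [->]. Qed.

Lemma is_cat3P p q r w : is_cat3 p q r w <->
  [/\ ptgt p = psrc q, ptgt q = psrc r, psrc w = psrc p &
      parr w = parr p ++ parr q ++ parr r].
Proof.
split=> [[pq hpq /pcatP[e1 e2 e3]]|[e1 e2 e3 e4]].
  have e := ptgt_cat hpq; have /pcatP[f1 f2 f3] := hpq.
  by split; rewrite ?e2 ?e3 ?f3 ?catA // -e1 e.
have [pq hpq] := pcat_some e1; exists pq => //.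
have /pcatP[f1 f2 f3] := hpq; apply/pcatP; split.
- by rewrite (ptgt_cat hpq).
- by rewrite e3 f2.
- by rewrite e4 f3 catA.
Qed.

Lemma is_cat3_ex p q r : ptgt p = psrc q -> ptgt q = psrc r ->
  exists w, is_cat3 p q r w.
Proof.
move=> e1 e2; have [pq hpq] := pcat_some e1.
have /pcat_some[w hw] : ptgt pq = psrc r by rewrite (ptgt_cat hpq).
by exists w, pq.
Qed.

Lemma is_cat3_tgt p q r w : is_cat3 p q r w -> ptgt w = ptgt r.
Proof. by case=> pq _ /ptgt_cat. Qed.

Lemma ptgt_parr p : ptgt p = last (psrc p) (map (@tgt Q) (parr p)).
Proof. by []. Qed.

Lemma split3 w s1 s2 s3 : parr w = s1 ++ s2 ++ s3 ->
  exists p q r, [/\ is_cat3 p q r w, parr p = s1, parr q = s2 & parr r = s3].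
Proof.
move=> e; have := composableP w; rewrite e !composable_cat => /and3P[c1 c2 c3].
pose p : qpath Q := @QPath Q (psrc w, s1) c1.
pose q : qpath Q := @QPath Q (ptgt p, s2) c2.
pose r : qpath Q := @QPath Q (ptgt q, s3) c3.
by exists p, q, r; split=> //; apply/is_cat3P; split.
Qed.

Lemma split2 w s1 s2 : parr w = s1 ++ s2 ->
  exists p q, [/\ is_cat p q w, parr p = s1 & parr q = s2].
Proof.
move=> e; have [|p [q [r [/is_cat3P[e1 e2 e3 e4] h1 h2 h3]]]] :=
  @split3 w s1 s2 [::]; first by rewrite cats0.
exists p, q; split=> //; apply/pcatP; split=> //.
by rewrite e4 h3 cats0.
Qed.

Lemma qpath_ind_rcons (P : qpath Q -> Prop) :
  (forall v : vert Q, P (stationary v)) ->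
  (forall p a r, P p -> is_cat p (arrow_path a) r -> P r) ->
  forall p, P p.
Proof.
move=> P0 P1 p; move: {2}(parr p) (erefl (parr p)) => s.
elim/last_ind: s p => [|s a IH] p e; first by rewrite (parr_nil e).
have [q [r [c eq er]]] : exists q r, [/\ is_cat q r p, parr q = s & parr r = [:: a]].
  by apply: split2; rewrite cats1.
suff er' : r = arrow_path a by subst r; apply: P1 c; apply: IH.
apply: qpath_eq => //; have := composableP r; rewrite er /=.
by move=> /andP[/eqP<-].
Qed.

Variable K : fieldType.

Lemma pbasisM p q : pbasis K p ** pbasis K q = basis_mul K p q.
Proof. exact: path_mul_basis. Qed.

Lemma pbasis_cat p q r : is_cat p q r -> pbasis K r = pbasis K p ** pbasis K q.
Proof. by move=> e; rewrite pbasisM /basis_mul e. Qed.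

Lemma pbasis_ncat p q : ptgt p <> psrc q -> pbasis K p ** pbasis K q = 0.
Proof. by move=> /pcat_None e; rewrite pbasisM /basis_mul e. Qed.

Lemma pbasis_cat3 p q r w : is_cat3 p q r w ->
  pbasis K w = pbasis K p ** pbasis K q ** pbasis K r.
Proof. by case=> pq /pbasis_cat <- /pbasis_cat. Qed.

Lemma pbasis_mul3 p q r :
  (exists2 w, is_cat3 p q r w & pbasis K p ** pbasis K q ** pbasis K r = pbasis K w) \/
  [/\ ~ (ptgt p = psrc q /\ ptgt q = psrc r) &
      pbasis K p ** pbasis K q ** pbasis K r = 0].
Proof.
have [e1|/eqP n1] := eqVneq (ptgt p) (psrc q); last first.
  by right; split=> [[]//|]; apply: numul3_eq0; left; apply: pbasis_ncat.
have [e2|/eqP n2] := eqVneq (ptgt q) (psrc r); last first.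
  by right; split=> [[]//|]; apply: numul3_eq0; right; apply: pbasis_ncat.
have [w hw] := is_cat3_ex e1 e2; left; exists w => //.
exact: esym (pbasis_cat3 hw).
Qed.

Lemma pbasis_srcM p : pbasis K (stationary (psrc p)) ** pbasis K p = pbasis K p.
Proof. by rewrite -(@pbasis_cat _ _ p) //; apply/pcatP. Qed.

Lemma pbasis_tgtM p : pbasis K p ** pbasis K (stationary (ptgt p)) = pbasis K p.
Proof. by rewrite -(@pbasis_cat _ _ p) //; apply/pcatP; split; rewrite //= cats0. Qed.

Definition loop_quadratic (a : arr Q) c1 c2 : pathalg K Q :=
  pbasis K (arrow_path a) ** pbasis K (arrow_path a)
  - c1 *: pbasis K (arrow_path a) - c2 *: pbasis K (stationary (src a)).

(** Expanding a quadratic relation between two paths gives three paths with common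
    ends, which is what the forms below are evaluated on. *)
Lemma loop_quadratic_composable (a : arr Q) c1 c2 y z :
  src a = tgt a -> ptgt y = src a -> psrc z = src a ->
  exists w0 w1 w2,
    [/\ [/\ psrc w0 = psrc y, ptgt w0 = ptgt z & parr w0 = parr y ++ [:: a, a & parr z]],
        [/\ psrc w1 = psrc y, ptgt w1 = ptgt z & parr w1 = parr y ++ a :: parr z],
        [/\ psrc w2 = psrc y, ptgt w2 = ptgt z & parr w2 = parr y ++ parr z] &
        pbasis K y ** loop_quadratic a c1 c2 ** pbasis K z =
        pbasis K w0 - c1 *: pbasis K w1 - c2 *: pbasis K w2].
Proof.
move=> loop ty sz.
have [q hq] : exists q, is_cat (arrow_path a) (arrow_path a) q.
  by apply: pcat_some; rewrite ptgt_arrow -loop.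
have /pcatP[_ sq aq] := hq; have tq := ptgt_cat hq.
have [w0 h0] : exists w, is_cat3 y q z w.
  by apply: is_cat3_ex; rewrite ?sq // tq ptgt_arrow -loop.
have [w1 h1] : exists w, is_cat3 y (arrow_path a) z w.
  by apply: is_cat3_ex; rewrite // ptgt_arrow -loop.
have [w2 h2] : exists w, is_cat3 y (stationary (src a)) z w.
  by apply: is_cat3_ex; rewrite // ptgt_stationary.
exists w0, w1, w2; split.
- by have /is_cat3P[_ _ -> ->] := h0; rewrite (is_cat3_tgt h0) aq.
- by have /is_cat3P[_ _ -> ->] := h1; rewrite (is_cat3_tgt h1).
- by have /is_cat3P[_ _ -> ->] := h2; rewrite (is_cat3_tgt h2).
rewrite (pbasis_cat3 h1) (pbasis_cat3 h2).
have := pbasis_cat3 h0; rewrite (pbasis_cat hq) => ->.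
exact: (@quadratic_distr K (pathalg K Q) (pbasis K y) (pbasis K z)
  (pbasis K (arrow_path a)) (pbasis K (stationary (src a))) c1 c2).
Qed.

Lemma loop_quadratic_ncomposable (a : arr Q) c1 c2 y z : src a = tgt a ->
  ~ (ptgt y = src a /\ psrc z = src a) ->
  pbasis K y ** loop_quadratic a c1 c2 ** pbasis K z = 0.
Proof.
move=> loop nyz.
apply: (@quadratic_zero K (pathalg K Q) (pbasis K y) (pbasis K z)
  (pbasis K (arrow_path a)) (pbasis K (stationary (src a))) c1 c2).
- exact: (pbasis_srcM (arrow_path a)).
- by rewrite {1}loop; apply: (pbasis_tgtM (arrow_path a)).
- exact: (pbasis_srcM (stationary (src a))).
have [ty|ny] := eqVneq (ptgt y) (src a); [right|left]; apply: pbasis_ncat.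
  by move=> sz; apply: nyz.
by move/eqP; rewrite (negPf ny).
Qed.

(** The step of the reduction to paths without squares of crease loops, in Q and
    in Q_R alike. *)
Lemma loop_square_reduce (a : arr Q) c1 c2 q w : src a = tgt a ->
  parr q = [:: a; a] -> subpath q w ->
  exists w1 w2 y z, [/\ (size (parr w1) < size (parr w))%N,
    (size (parr w2) < size (parr w))%N &
    pbasis K w - c1 *: pbasis K w1 - c2 *: pbasis K w2 =
    pbasis K y ** loop_quadratic a c1 c2 ** pbasis K z].
Proof.
move=> loop eq [y [z /is_cat3P[e1 e2 e3 e4]]].
have sq : psrc q = src a.
  by have := composableP q; rewrite eq /= => /andP[/eqP->].
have tq : ptgt q = src a by rewrite ptgt_parr eq.
have [|w0 [w1 [w2 [[s0 t0 a0] [s1 t1 a1] [s2 t2 a2] E]]]] :=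
  @loop_quadratic_composable a c1 c2 y z loop (etrans e1 sq).
  by rewrite -e2.
have -> : w = w0 by apply: qpath_eq; rewrite ?s0 ?e3 // e4 eq a0.
by exists w1, w2, y, z; rewrite E a0 a1 a2 !size_cat /= !addnS.
Qed.

(** Universal property of the path algebra: as there is no unit, the images of the
    vertices are arbitrary orthogonal idempotents E that the images of the arrows
    are compatible with. *)
Section Universal.
Variables (B : nualgType K) (E : vert Q -> B) (G : arr Q -> B).
Hypothesis EE : forall v w : vert Q, E v ** E w = if v == w then E v else 0.
Hypothesis EG : forall a, E (src a) ** G a = G a.
Hypothesis GE : forall a, G a ** E (tgt a) = G a.

Definition path_image p : B := foldl (fun x a => x ** G a) (E (psrc p)) (parr p).

Definition path_hom : pathalg K Q -> B := lin_ext path_image.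

HB.instance Definition _ := GRing.Linear.on path_hom.

Lemma path_hom_basis p : path_hom (pbasis K p) = path_image p.
Proof. exact: lin_extU. Qed.

Lemma path_image_rcons p a r : is_cat p (arrow_path a) r ->
  path_image r = path_image p ** G a.
Proof.
move=> /pcatP[_ e1 e2]; rewrite /path_image e1 e2 cats1.
by rewrite -cats1 foldl_cat.
Qed.

Lemma path_image_tgt p : path_image p ** E (ptgt p) = path_image p.
Proof.
elim/qpath_ind_rcons: p => [v|p a r IH c].
  by rewrite /path_image /= EE eqxx.
by rewrite (path_image_rcons c) (ptgt_cat c) ptgt_arrow -numulA GE.
Qed.

Lemma path_image_src p : E (psrc p) ** path_image p = path_image p.
Proof.
elim/qpath_ind_rcons: p => [v|p a r IH c].
  by rewrite /path_image /= EE eqxx.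
by rewrite (path_image_rcons c) numulA; have /pcatP[_ -> _] := c; rewrite IH.
Qed.

Lemma path_hom_arrow a : path_hom (pbasis K (arrow_path a)) = G a.
Proof. by rewrite path_hom_basis /path_image /= EG. Qed.

Lemma path_hom_stationary v : path_hom (pbasis K (stationary v)) = E v.
Proof. by rewrite path_hom_basis. Qed.

Lemma path_image_mul p q : path_image p ** path_image q =
  if pcat p q is Some r then path_image r else 0.
Proof.
case e: (pcat p q) => [r|]; last first.
  rewrite -[path_image p]path_image_tgt -[path_image q]path_image_src numulA.
  rewrite -[_ ** E _ ** E _]numulA EE.
  by case: eqP => [|_]; [move/pcat_None: e | rewrite numulr0 numul0r].
elim/qpath_ind_rcons: q r e => [v|q a r IH c] r' e.
  have /pcatP[e0 e1 e2] := e.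
  have -> : path_image (stationary v) = E (ptgt p) by rewrite e0.
  rewrite path_image_tgt.
  by congr path_image; apply: qpath_eq; rewrite ?e1 // e2 cats0.
rewrite (path_image_rcons c) numulA.
have e' : ptgt p = psrc q.
  by have /pcatP[-> _ _] := e; have /pcatP[_ -> _] := c.
have [pq hpq] := pcat_some e'; rewrite (IH _ hpq); apply/esym/path_image_rcons.
apply/pcatP; have /pcatP[_ c2 c3] := c; have /pcatP[_ f2 f3] := e.
have /pcatP[h1 h2 h3] := hpq; split.
- by rewrite (ptgt_cat hpq); have /pcatP[] := c.
- by rewrite f2 h2.
- by rewrite f3 c3 h3 catA.
Qed.

Lemma path_homM : {morph path_hom : x y / x ** y}.
Proof.
have L (V : nualgType K) (F : pathalg K Q -> V) (y : V) : linear F ->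
    linear (fun x => F x ** y).
  by move=> lF c u v; rewrite lF numul_linearl.
have R (V : nualgType K) (F : pathalg K Q -> V) (y : V) : linear F ->
    linear (fun x => y ** F x).
  by move=> lF c u v; rewrite lF numul_linearr.
have lh : linear path_hom by exact: lin_ext_linear.
move=> x y.
apply: (eq_linear_pbasis (F := fun x => path_hom (x ** y))
  (G := fun x => path_hom x ** path_hom y)) x => [c u v||p].
- by rewrite numul_linearl lh.
- exact: L.
apply: (eq_linear_pbasis (F := fun y => path_hom (pbasis K p ** y))
  (G := fun y => path_hom (pbasis K p) ** path_hom y)) y => [c u v||q].
- by rewrite numul_linearr lh.
- exact: R.
apply: etrans _ (esym (f_equal2 numul (path_hom_basis p) (path_hom_basis q))).
rewrite path_image_mul pbasisM /basis_mul.
by case: pcat => [r|]; [rewrite (path_hom_basis r)|rewrite linear0].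
Qed.

End Universal.

End PathLemmas.

Lemma dual_quot_ext (K : fieldType) (Q : quiver) (Z : set (pathalg K Q))
    (f g : dual (quotalg Z)) :
  (forall w, f (quot_proj Z (pbasis K w)) = g (quot_proj Z (pbasis K w))) -> f = g.
Proof.
move=> fg; apply: dualP => x; rewrite -[x]quot_reprK.
move: (quot_repr x) => {}x.
have lin (h : dual (quotalg Z)) : linear (fun x => h (quot_proj Z x)).
  by move=> c y z; rewrite linearP dual_scalar.
exact: (eq_linear_pbasis (lin f) (lin g) fg x).
Qed.

(** * Reduced words of a folded gentle quiver *)

Section Words.
Variables (K : fieldType) (T : folded_triple K).
Hypothesis hT : folded_gentle T.
Local Notation Q := (fquiver T).
Implicit Types (a b c : arr Q) (s l r t : seq (arr Q)) (u : cvert T) (v : vert Q).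

Definition ord_pair a b := exists2 z, ord_rel T z & parr z = [:: a; b].

Definition crease (a : arr Q) : bool := if a is inr _ then true else false.

Definition follows a b : bool :=
  [&& tgt a == src b, ~~ `[< ord_pair a b >] & ~~ (crease a && crease b)].

Lemma crease_loop_src (a : arr Q) u : crease a -> src a = inr u -> a = inr u.
Proof. by case: a => [//|w] _ /= [->]. Qed.

Lemma crease_loop_tgt (a : arr Q) u : crease a -> tgt a = inr u -> a = inr u.
Proof. by case: a => [//|w] _ /= [->]. Qed.

Lemma pair_path a b : tgt a = src b -> exists p : qpath Q, parr p = [:: a; b].
Proof.
move=> e; have /pcat_some[p /pcatP[_ _ ep]] :
  ptgt (arrow_path a) = psrc (arrow_path b) by [].
by exists p.
Qed.

Lemma ord_rel_pair p a b : parr p = [:: a; b] -> ord_rel T p <-> ord_pair a b.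
Proof.
move=> e; split=> [h|[z hz ez]]; first by exists p.
suff -> : p = z by [].
by apply: qpath_eq_tgt; rewrite ?e ?ez // !ptgt_parr e ez.
Qed.

Lemma ord_pair_ordinary a b : ord_pair a b -> ~~ crease a && ~~ crease b.
Proof.
by move=> [z /(fg_ord_rel hT)[_]] + e; rewrite e; case: a {e} => ?; case: b.
Qed.

Lemma two_arrows (A : {set farr T}) (x y z : farr T) : (#|A| <= 2)%N ->
  x \in A -> y \in A -> z \in A -> y != x -> z != x -> y = z.
Proof.
move=> cA xA yA zA yx zx; apply/eqP; apply: contraTT cA => yz.
rewrite -ltnNge; have /subset_leq_card/(leq_trans _)-> // : [set x; y; z]%SET \subset A.
  by apply/fintype.subsetP => w /[!inE] /orP[/orP[]|] /eqP->.
by rewrite -finset.setUA cardsU1 cards2 !inE yz ![x == _]eq_sym (negPf yx) (negPf zx).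
Qed.

(** At an ordinary arrow this is [fg2_right].  At a crease loop it is [fg1_src]: of the two
    arrows that may start at the vertex, one is the loop itself. *)
Lemma follows_detr a b c : follows a b -> follows a c -> b = c.
Proof.
move=> /and3P[/eqP e1 /asboolPn n1 c1] /and3P[/eqP e2 /asboolPn n2 c2].
case: a e1 e2 n1 n2 c1 c2 => [a|u] e1 e2 n1 n2 c1 c2.
  apply: (fg2_right hT (b := a)).
  - by have [p ep] := pair_path e1; exists p => //; rewrite (ord_rel_pair ep).
  - by have [p ep] := pair_path e2; exists p => //; rewrite (ord_rel_pair ep).
apply: (two_arrows (x := inr u) (fg1_src hT (inr u))); rewrite ?inE //=.
- exact/eqP/esym.
- exact/eqP/esym.
- by case: (b) c1.
- by case: (c) c2.
Qed.

Lemma follows_detl a b c : follows a c -> follows b c -> a = b.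
Proof.
move=> /and3P[/eqP e1 /asboolPn n1 c1] /and3P[/eqP e2 /asboolPn n2 c2].
case: c e1 e2 n1 n2 c1 c2 => [c|u] e1 e2 n1 n2 c1 c2.
  apply: (fg2_left hT (b := c)).
  - by have [p ep] := pair_path e1; exists p => //; rewrite (ord_rel_pair ep).
  - by have [p ep] := pair_path e2; exists p => //; rewrite (ord_rel_pair ep).
apply: (two_arrows (x := inr u) (fg1_tgt hT (inr u))); rewrite ?inE //=.
- exact/eqP.
- exact/eqP.
- by case: (a) c1.
- by case: (b) c2.
Qed.

Lemma follows_crease a u : ~~ crease a -> tgt a = inr u -> follows a (crease_loop u).
Proof.
move=> na ta; rewrite /follows ta eqxx (negPf na) /= andbT.
by apply/asboolPn => /ord_pair_ordinary; rewrite andbF.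
Qed.

Lemma crease_follows a u : ~~ crease a -> src a = inr u -> follows (crease_loop u) a.
Proof.
move=> na ta; rewrite /follows ta eqxx /= (negPf na) /= andbT.
by apply/asboolPn => /ord_pair_ordinary.
Qed.

(** An ordinary arrow into a crease vertex is followed by the loop, and then by
    nothing else, because ordinary relations contain no crease loop: a reduced path
    runs through a crease vertex along its loop. *)
Lemma follows_at_crease a b u : follows a b -> tgt a = inr u ->
  (a == crease_loop u) (+) (b == crease_loop u).
Proof.
move=> ab ta; have [/eqP sab _ nab] := and3P ab.
have [ca|na] := boolP (crease a).
  have ea := crease_loop_tgt ca ta; rewrite {1}ea eqxx /=.
  by apply: contra nab => /eqP->; rewrite ca.
rewrite (follows_detr ab (follows_crease na ta)) eqxx addbT.
by apply: contra na => /eqP->.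
Qed.

(** By [fg4] all the forbidden subpaths have length two, so being reduced is a
    condition on consecutive arrows. *)
Lemma reduced_sorted (p : qpath Q) : reduced_path p <-> sorted follows (parr p).
Proof.
split=> [red|srt q [u [v /is_cat3P[_ _ _ e]]]].
  case e: (parr p) => [//|a s] /=; apply/(pathP a) => i hi.
  have hi' : (i < size (a :: s))%N by rewrite /= ltnW.
  set b := nth a (a :: s) i; set c := nth a s i.
  have e1 : parr p = take i (a :: s) ++ [:: b; c] ++ drop i.+1 s.
    by rewrite e -{1}[a :: s](cat_take_drop i) (drop_nth a hi') /= (drop_nth a hi).
  have [x [q [y [h1 h2 h3 h4]]]] := @split3 _ p (take i (a :: s)) [:: b; c] _ e1.
  have [nz nc] := red q (ex_intro _ x (ex_intro _ y h1)).
  have := composableP q; rewrite h3 /= => /and3P[/eqP e2 /eqP e3 _].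
  apply/and3P; split.
  - exact/eqP/esym.
  - by apply/asboolPn; rewrite -(ord_rel_pair h3).
  - apply/negP => /andP[cb cc]; apply: nc.
    move: h3 e3 cb; case: (b) => // b' h3 e3 _; exists b'.
    by rewrite h3; congr [:: _; _]; apply: crease_loop_src.
have sq : sorted follows (parr q).
  by move: srt; rewrite e => /cat_sorted2[_ /cat_sorted2[]].
split=> [zq|[w ew]].
  have := fg4 hT zq; case eq: (parr q) sq => [|a [|b []]] //= /andP[/and3P[_ + _] _] _.
  by move=> /asboolPn[]; exists q.
by move: sq; rewrite ew /= andbT => /and3P[].
Qed.

(** * Coefficients of words *)

(** A word t is fixed and cut as t = catrev l r, so that the pair (l, r) stands for
    the prefix rev l of t.  The arrows act from the right on the space spanned by
    these prefixes: an arrow leads to the next prefix if it is the next letter, a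
    crease loop acts on a prefix that ends with it by its quadratic relation, and
    everything else is 0.  The value coef s l r is the coefficient of t itself in
    the image of the prefix under the word s. *)
Fixpoint coef (s l r : seq (arr Q)) : K :=
  if s is a :: s' then
    (if r is b :: r' then if b == a then coef s' (a :: l) r' else 0 else 0) +
    (if a is inr u then
       if l is b :: l' then
         if b == a then lam1 T u * coef s' l r + lam2 T u * coef s' l' (a :: r)
         else 0
       else 0
     else 0)
  else (r == [::])%:R.

(** Reducedness with respect to the squares of crease loops only; consecutive
    crease loops of a path are equal, for they share their vertex. *)
Definition tame s : bool := sorted (fun a b => ~~ (crease a && crease b)) s.

Arguments tame : simpl never.

Lemma follows_tame s : sorted follows s -> tame s.
Proof. by apply: sub_sorted => a b /and3P[]. Qed.

Definition crease_head s : bool := if s is a :: _ then crease a else false.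

Lemma tame_cons a s : tame (a :: s) = ~~ (crease a && crease_head s) && tame s.
Proof. by case: s => [|b s] //=; rewrite /tame /= ?andbF. Qed.

(** Each letter moves ahead by at most one prefix, so that a word that is not longer
    than what remains of t reaches t only by spelling it.  All the linear
    independence needed below follows from this. *)
Lemma coef_size s l r : (size s <= size r)%N -> coef s l r = (s == r)%:R.
Proof.
elim: s l r => [|a s IH] l r; first by rewrite eq_sym.
case: r => [//|b r] le; have {}le : (size s <= size r)%N := le.
have -> : coef (a :: s) l (b :: r) = if b == a then coef s (a :: l) r else 0.
  have ne r' : (size s < size r')%N -> (s == r') = false.
    by move=> h; apply: contraTF h => /eqP->; rewrite ltnn.
  rewrite /=; case: (a) => [a'|u]; rewrite ?addr0 //.
  case: l => [|c l]; rewrite ?addr0 //.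
  case: (c == _); rewrite ?addr0 //. rewrite (IH (c :: l) (b :: r)) ?leqW //.
  by rewrite (IH l [:: inr u, b & r]) ?ne /= ?ltnS ?leqW // !mulr0 !addr0.
rewrite eqseq_cons eq_sym; case: eqP => [->|_] //=.
by rewrite IH.
Qed.

Definition count_ordinary s := count (fun a => ~~ crease a) s.

(** The ordinary arrows grade the action: each one moves from a prefix to the next
    one, whereas a crease loop never passes an ordinary letter. *)
Lemma coef_count_ordinary s l r : coef s l r != 0 -> count_ordinary s = count_ordinary r.
Proof.
elim: s l r => [|a s IH] l r; first by case: r => //=; rewrite eqxx.
rewrite /=; set x := (X in X + _); set y := (X in _ + X).
have [x0|xn _] := eqVneq x 0; last first.
  move: xn; rewrite /x; case: (r) => [|b r']; rewrite ?eqxx //.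
  by case: (b =P a) => [->|_]; rewrite ?eqxx // => /IH /= ->.
rewrite x0 add0r /y; case: a {x x0 y} => [a|u]; rewrite ?eqxx //.
case: l => [|b l]; rewrite ?eqxx //; case: (b == _); rewrite ?eqxx //.
set x := coef s _ r; have [x0|xn _] := eqVneq x 0; last by rewrite (IH _ _ xn).
by rewrite x0 mulr0 add0r mulf_eq0 negb_or => /andP[_ /IH].
Qed.

(** A quadratic relation is used only when a crease loop meets the same loop at the
    end of the prefix, which a tame word started elsewhere avoids. *)
Lemma coef_cat s (b : seq (arr Q)) l r : tame s -> ~~ (crease_head s && crease_head l) ->
  coef (s ++ b) l (s ++ r) = coef b (catrev s l) r.
Proof.
elim: s l => [//|a s IH] l; rewrite tame_cons => /andP[h ts] hl.
rewrite /= eqxx IH //; last by rewrite /= andbC.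
case: a h hl => [a|u] h hl; rewrite ?addr0 //.
case: l hl => [|c l] hl; rewrite ?addr0 //.
by case: (c =P inr u) hl => [->|_]; rewrite ?addr0.
Qed.

Lemma coef_prefix s (b : seq (arr Q)) l r : tame s -> ~~ (crease_head s && crease_head l) ->
  coef (s ++ b) l r != 0 -> exists r', r = s ++ r'.
Proof.
elim: s l r => [|a s IH] l r; first by exists r.
rewrite tame_cons => /andP[h ts] hl.
have -> : coef ((a :: s) ++ b) l r =
    if r is c :: r' then if c == a then coef (s ++ b) (a :: l) r' else 0 else 0.
  rewrite /=; case: a h hl => [a|u] h hl; rewrite ?addr0 //.
  case: l hl => [|c l] hl; rewrite ?addr0 //.
  by case: (eqVneq c (inr u)) hl => [->|_]; rewrite ?addr0.
case: r => [|c r]; rewrite ?eqxx //; case: (c =P a) => [->|_]; rewrite ?eqxx //.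
move=> /IH[||r' ->] //; last by exists r'.
by rewrite /= andbC.
Qed.

Lemma coef_full s l r : tame s -> ~~ (crease_head s && crease_head l) ->
  coef s l r != 0 -> r = s.
Proof.
move=> ts hs; rewrite -[s]cats0 => nz.
have [r' er] := coef_prefix ts hs nz; move: nz; rewrite er coef_cat //=.
by case: (r') => [|? ?] /=; rewrite ?cats0 ?mulr0n ?eqxx.
Qed.

Lemma tame_catrevr l r : tame (catrev l r) -> tame r.
Proof. by elim: l r => [//|a l IH] r /= /IH; rewrite tame_cons => /andP[]. Qed.

Lemma tame_catrevl l r : tame (catrev l r) -> tame l.
Proof.
elim: l r => [//|a l IH] r /= h; rewrite tame_cons (IH _ h) andbT.
case: l h {IH} => [|b l] /= h; first by rewrite andbF.
by have := tame_catrevr h; rewrite tame_cons /= [crease b && _]andbC => /andP[].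
Qed.

(** The mirror image of the previous lemmas: the tame word q at the end has to be
    the end of t.  The quadratic relation leaves one exception, that q uses again
    the crease loop at which the prefix already ends. *)
Lemma coef_suffix (b q : seq (arr Q)) l r : tame q -> tame (catrev l r) ->
  coef (b ++ q) l r != 0 ->
  (exists m, r = m ++ q) \/
  (exists u l', l = crease_loop u :: l' /\ q = crease_loop u :: r).
Proof.
move=> tq; elim: b l r => [|a b IH] l r tl.
  case: q tq => [|a q] tq; first by left; exists r; rewrite cats0.
  move: (tq); rewrite tame_cons => /andP[hq tq'] /=.
  set x := (X in X + _); set y := (X in _ + X).
  have [x0|xn _] := eqVneq x 0; last first.
    left; exists [::]; move: xn; rewrite /x; case: (r) => [|b r']; rewrite ?eqxx //.
    case: (b =P a) => [->|_]; rewrite ?eqxx // => /coef_full-> //.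
    by rewrite /= andbC.
  rewrite x0 add0r {x x0} /y; case: a hq {tq} => [a|u] hq; rewrite ?eqxx //.
  case: l tl => [|c l] tl; rewrite ?eqxx //.
  case: (c =P inr u) tl => [->|_] tl; rewrite ?eqxx //.
  set x := coef q _ r; have [x0|xn _] := eqVneq x 0.
    rewrite x0 mulr0 add0r mulf_eq0 negb_or => /andP[_ nz].
    have er : crease_loop u :: r = q.
      by apply: coef_full nz => //; move: (tame_catrevl tl);
        rewrite tame_cons /= => /andP[/negPf-> _]; rewrite andbF.
    by rewrite -er in hq.
  right; exists u, l; split=> //; congr (_ :: _); apply: esym; apply: coef_full xn => //.
  by rewrite andbC.
rewrite cat_cons /=; set x := (X in X + _); set y := (X in _ + X).
have [x0|xn _] := eqVneq x 0; last first.
  move: xn; rewrite /x {x y}; case: r tl => [|c r'] tl; rewrite ?eqxx //.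
  case: (c =P a) tl => [->|_] tl; rewrite ?eqxx // => /IH[].
  - by [].
  - by move=> [m ->]; left; exists (a :: m).
  - by move=> [u [l' [[-> _] ->]]]; left; exists [::].
rewrite x0 add0r {x x0} /y; case: a => [a|u]; rewrite ?eqxx //.
case: l tl => [|c l] tl; rewrite ?eqxx //.
case: (c =P inr u) tl => [->|_] tl; rewrite ?eqxx //.
set x := coef _ _ r; have [x0|xn _] := eqVneq x 0; last exact: IH xn.
rewrite x0 mulr0 add0r mulf_eq0 negb_or => /andP[_ /IH[]].
- by [].
- move=> [[|d m] /= [e]]; first by move: e => <-; right; exists u, l.
  by move=> ->; left; exists m.
- by move=> [u' [l' [-> eq]]]; move: tq; rewrite eq.
Qed.

End Words.

Arguments tame : simpl never.

(** * Saturated paths *)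

Section Saturated.
Variables (K : fieldType) (T : folded_triple K).
Hypothesis hT : folded_gentle T.
Local Notation Q := (fquiver T).
Local Notation follows := (@follows K T).
Local Notation coef := (@coef K T).
Implicit Types (a b c : arr Q) (s l r t : seq (arr Q)) (u : cvert T) (v : vert Q).
Implicit Types (p q m w : qpath Q).

(** The vertex at the end of the prefix rev l. *)
Definition reached v l : vert Q := if l is a :: _ then tgt a else v.

(** A saturated path passes along the loop at every crease vertex on it, also at its
    two ends.  For such paths, and not for arbitrary reduced ones, the action on
    prefixes satisfies the crease relations. *)
Definition saturated p : Prop :=
  [/\ sorted follows (parr p),
      forall u, psrc p = inr u -> ohead (parr p) = Some (crease_loop u) &
      forall u, ptgt p = inr u -> ohead (rev (parr p)) = Some (crease_loop u)].

Lemma sorted_catrevr (R : rel (arr Q)) l r : sorted R (catrev l r) -> sorted R r.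
Proof. by elim: l r => [//|a l IH] r /= /IH /path_sorted. Qed.

Lemma composable_catrev v l r : composable v (catrev l r) -> composable (reached v l) r.
Proof.
elim: l r => [//|a l IH] r /= /IH.
by rewrite /= => /andP[_].
Qed.

Lemma reached_catrev v l r : last v (map (@tgt Q) (catrev l r)) =
  last (reached v l) (map (@tgt Q) r).
Proof. by elim: l r => [//|a l IH] r; rewrite /= IH. Qed.

Lemma saturatedP p l r u : saturated p -> catrev l r = parr p ->
  reached (psrc p) l = inr u ->
  (ohead l == Some (crease_loop u)) (+) (ohead r == Some (crease_loop u)).
Proof.
move=> [srt hs ht] e.
case: l e => [|a l] e ev.
  by rewrite /= in e; rewrite /= e (hs u) ?eqxx.
case: r e => [|b r] e.
  have ha : ohead (rev (parr p)) = Some a by rewrite -e catrevE cats0 revK.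
  have := ht u; rewrite ha ptgt_parr -e reached_catrev => /(_ ev) [->].
  by rewrite /= eqxx.
have /sorted_catrevr/= /andP[ab _] : sorted follows (catrev l [:: a, b & r]).
  by rewrite -e in srt.
exact: follows_at_crease ab ev.
Qed.

Lemma coef_ord (y z : seq (arr Q)) a b l r : sorted follows (catrev l r) ->
  ord_pair a b -> coef (y ++ [:: a; b] ++ z) l r = 0.
Proof.
move=> + ab; elim: y l r => [|c y IH] l r.
  have /andP[] := ord_pair_ordinary hT ab.
  case: a ab => // a ab _; case: b ab => // b ab _ /=.
  case: r => [|c r]; rewrite ?addr0 //; case: (c =P _) => [->|_]; rewrite ?addr0 //.
  case: r => [|d r]; rewrite ?addr0 //; case: (d =P _) => [->|_]; rewrite ?addr0 //.
  by move=> /sorted_catrevr/= /andP[/and3P[_ /asboolPn[]]].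
move=> srt; rewrite /=.
set x := (X in X + _); have -> : x = 0.
  rewrite /x; case: r srt {x} => [//|d r] srt.
  by case: (d =P c) srt => // -> srt; apply: IH.
rewrite add0r {x}; case: c => [//|u]; case: l srt => [//|d l] srt.
case: (d =P inr u) srt => // -> srt.
by rewrite !IH // !mulr0 addr0.
Qed.

Lemma coef_loopL u s l r : ohead r != Some (crease_loop u) ->
  coef (crease_loop u :: s) (crease_loop u :: l) r =
  lam1 T u * coef s (crease_loop u :: l) r + lam2 T u * coef s l (crease_loop u :: r).
Proof.
rewrite /= eqxx; case: r => [|c r] /=; rewrite ?add0r //.
case: (c =P crease_loop u) => [->|_]; rewrite ?add0r //.
by rewrite eqxx.
Qed.

Lemma coef_loopR u s l r : ohead l != Some (crease_loop u) ->
  coef (crease_loop u :: s) l (crease_loop u :: r) = coef s (crease_loop u :: l) r.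
Proof.
rewrite /= eqxx; case: l => [|c l] /=; rewrite ?addr0 //.
case: (c =P crease_loop u) => [->|_]; rewrite ?addr0 //.
by rewrite eqxx.
Qed.

Lemma tame_loop u s : tame (crease_loop u :: s) -> ohead s != Some (crease_loop u).
Proof.
case: s => [//|c s]; rewrite tame_cons => /andP[h _].
by apply: contra h => /eqP[->].
Qed.

(** At a crease vertex exactly one side of the cut shows the loop; the prefixes
    before and after this loop span a copy of the quotient of K[x] by the quadratic
    polynomial, with the loop acting as x. *)
Lemma coef_crease0 p (z : seq (arr Q)) u l r : saturated p -> catrev l r = parr p ->
  reached (psrc p) l = inr u ->
  coef [:: crease_loop u, crease_loop u & z] l r =
  lam1 T u * coef (crease_loop u :: z) l r + lam2 T u * coef z l r.
Proof.
move=> sp e ev; have := saturatedP sp e ev.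
have tm : tame (catrev l r) by rewrite e; apply: follows_tame; case: sp.
have [hl|hl] := boolP (ohead l == _); have [hr|hr] := boolP (ohead r == _) => // _.
  case: l hl e ev tm => // c l /eqP[->] _ _ tm.
  by rewrite coef_loopL // coef_loopR // tame_loop // (tame_catrevl tm).
case: r hr e tm => // c r /eqP[->] _ tm.
by rewrite !coef_loopR // coef_loopL // tame_loop // (tame_catrevr tm).
Qed.

Lemma coef_crease p (y z : seq (arr Q)) u l r : saturated p -> catrev l r = parr p ->
  composable (reached (psrc p) l) y ->
  last (reached (psrc p) l) (map (@tgt Q) y) = inr u ->
  coef (y ++ [:: crease_loop u, crease_loop u & z]) l r =
  lam1 T u * coef (y ++ crease_loop u :: z) l r + lam2 T u * coef (y ++ z) l r.
Proof.
move=> sp; elim: y l r => [|a y IH] l r e.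
  by move=> _; apply: coef_crease0 e.
rewrite [composable _ _]/= => /andP[/eqP sa cy]; rewrite [last _ _]/= => ty.
rewrite !cat_cons ![coef (a :: _) _ _]/=.
set F := fun s => if r is b :: r' then if b == a then coef s (a :: l) r' else 0 else 0.
set G := fun s => if a is inr u then if l is b :: l' then
  if b == a then lam1 T u * coef s l r + lam2 T u * coef s l' (a :: r)
  else 0 else 0 else 0.
have EF : F (y ++ [:: crease_loop u, crease_loop u & z]) =
    lam1 T u * F (y ++ crease_loop u :: z) + lam2 T u * F (y ++ z).
  rewrite /F; case: r e {F G} => [|b r] e; first by rewrite !mulr0 addr0.
  case: (b =P a) e => [->|_] e; last by rewrite !mulr0 addr0.
  exact: IH.
have EG : G (y ++ [:: crease_loop u, crease_loop u & z]) =
    lam1 T u * G (y ++ crease_loop u :: z) + lam2 T u * G (y ++ z).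
  rewrite /G; case: a sa cy ty {F G EF} => [a|u'] sa cy ty.
    by rewrite !mulr0 addr0.
  case: l e sa => [|b l] e sa; first by rewrite !mulr0 addr0.
  case: (b =P inr u') e sa => [->|_] e sa; last by rewrite !mulr0 addr0.
  have el : reached (psrc p) l = inr u'.
    have := composableP p; rewrite -e => /(@composable_catrev _ l (inr u' :: r)).
    by move=> /andP[/eqP<-].
  rewrite (IH (inr u' :: l)) ?(IH l) ?el //; first by ring.
transitivity (F (y ++ [:: crease_loop u, crease_loop u & z]) +
              G (y ++ [:: crease_loop u, crease_loop u & z])) => //.
rewrite EF EG; transitivity (lam1 T u * (F (y ++ crease_loop u :: z)
  + G (y ++ crease_loop u :: z)) + lam2 T u * (F (y ++ z) + G (y ++ z))) => //.
by ring.
Qed.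

End Saturated.

(** * The forms p^* on A *)

Section TopForms.
Variables (K : fieldType) (T : folded_triple K).
Hypothesis hT : folded_gentle T.
Local Notation Q := (fquiver T).
Local Notation A := (folded_algebra T).
Local Notation follows := (@follows K T).
Local Notation coef := (@coef K T).
Implicit Types (a b c : arr Q) (s l r t : seq (arr Q)) (u : cvert T) (v : vert Q).
Implicit Types (p q m w : qpath Q).

(** For a maximal path p this is the coefficient of p in the basis of reduced paths,
    that is, the form p^* in DA; no such basis enters. *)
Definition top_coef p w : K^o :=
  if (psrc w == psrc p) && (ptgt w == ptgt p) then coef (parr w) [::] (parr p) else 0.

Definition top_form p : {linear pathalg K Q -> K^o} := lin_ext (top_coef p).

Lemma top_form_basis p w : top_form p (pbasis K w) = top_coef p w.
Proof. exact: lin_extU. Qed.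

(** The sum of the finitely many stationary paths is a unit of KQ, so that a map
    killing all y ** x ** z kills x. *)
Lemma linear_ideal_gen (Z : set (pathalg K Q)) (L : {linear pathalg K Q -> K^o}) x :
  (forall y z x, Z x -> L (pbasis K y ** x ** pbasis K z) = 0) ->
  ideal_gen Z x -> L x = 0.
Proof.
move=> LZ Ix.
have {Ix} Ix : forall y z, L (y ** x ** z) = 0.
  apply: (Ix _ (sandwich_ideal L)) => x' Zx' y z.
  apply: (eq_linear_pbasis (F := fun y => L (y ** x' ** z)) (G := fun=> 0)) y => [||y].
  - exact: linear_mull.
  - exact: linear_cst0.
  apply: (eq_linear_pbasis (F := fun z => L (pbasis K y ** x' ** z)) (G := fun=> 0))
    z => [||z].
  - exact: linear_mulr.
  - exact: linear_cst0.
  exact: LZ.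
pose e : pathalg K Q := \sum_(v : fvert T) pbasis K (stationary (v : vert Q)).
have eE p : e ** pbasis K p = pbasis K p.
  apply: (sum_unitl (i := psrc p : fvert T)) => [|v nv]; first exact: pbasis_srcM.
  by apply: pbasis_ncat; rewrite ptgt_stationary => /eqP; rewrite (negPf nv).
have Ee p : pbasis K p ** e = pbasis K p.
  apply: (sum_unitr (i := ptgt p : fvert T)) => [|v nv]; first exact: pbasis_tgtM.
  by apply: pbasis_ncat => /esym/eqP; rewrite (negPf nv).
rewrite -(Ix e e); move: x {Ix}; apply: (eq_linear_pbasis (F := L) (G := fun x => L (e ** x ** e))) => [||p].
- move=> c x1 x2; exact: (linearP L).
- exact: linear_mulm.
by rewrite eE Ee.
Qed.

Lemma top_form_ideal p x : saturated p -> ideal_gen (relations T) x -> top_form p x = 0.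
Proof.
move=> sp; apply: linear_ideal_gen => y z _ [[q zq <-]|[u _ <-]].
  have [[w hw ->]|[_ ->]] := pbasis_mul3 K y q z; last by rewrite linear0.
  rewrite top_form_basis /top_coef; case: ifP => // _.
  have /is_cat3P[_ _ _ ->] := hw.
  have := fg4 hT zq; case eq: (parr q) => [|a [|b []]] // _.
  apply: (coef_ord hT) => //=; first by case: sp.
  by exists q.
pose a : arr Q := crease_loop u.
change (top_form p (pbasis K y ** loop_quadratic a (lam1 T u) (lam2 T u) ** pbasis K z) = 0).
have [ty|ny] := eqVneq (ptgt y) (src a); last first.
  by rewrite loop_quadratic_ncomposable ?linear0 // => -[/eqP]; rewrite (negPf ny).
have [sz|nz] := eqVneq (psrc z) (src a); last first.
  by rewrite loop_quadratic_ncomposable ?linear0 // => -[_ /eqP]; rewrite (negPf nz).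
have [w0 [w1 [w2 [[s0 t0 a0] [s1 t1 a1] [s2 t2 a2] ->]]]] :=
  @loop_quadratic_composable Q K a (lam1 T u) (lam2 T u) y z erefl ty sz.
apply: (etrans (linear_quadratic (top_form p) _ _ _ _ _)).
apply: (etrans (f_equal3 (fun x y z : K^o => x - lam1 T u *: y - lam2 T u *: z)
  (top_form_basis p w0) (top_form_basis p w1) (top_form_basis p w2))).
rewrite /top_coef s0 s1 s2 t0 t1 t2.
have [/andP[/eqP s3 /eqP t3]|_] := boolP (_ && _); last by rewrite !scaler0 !subr0.
rewrite a0 a1 a2.
have -> := @coef_crease K T hT p (parr y) (parr z) u [::] (parr p) sp erefl.
- by rewrite /GRing.scale /=; ring.
- by rewrite /= -s3; apply: composableP.
by rewrite /= -s3 -[last _ _]/(ptgt y) ty.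
Qed.

Lemma top_form_dual p : saturated p ->
  exists d : dual A, forall x, d (quot_proj _ x) = top_form p x.
Proof. by move=> sp; apply: dual_quot => x; apply: top_form_ideal. Qed.

End TopForms.

(** * Lengths of reduced paths *)

Section Bounded.
Variables (K : fieldType) (T : folded_triple K).
Hypothesis hT : folded_gentle T.
Local Notation Q := (fquiver T).
Local Notation A := (folded_algebra T).
Local Notation follows := (@follows K T).
Local Notation coef := (@coef K T).
Implicit Types (a b c : arr Q) (s l r t : seq (arr Q)) (u : cvert T) (v : vert Q).
Implicit Types (p q m w : qpath Q).

Lemma sorted_rcons2 (R : rel (arr Q)) s b c :
  sorted R (rcons (rcons s b) c) = sorted R (rcons s b) && R b c.
Proof.
by case: s => [|x s] /=; rewrite ?andbT // !rcons_path last_rcons.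
Qed.

Lemma follows_loop_source p u : sorted follows (parr p) -> psrc p = inr u ->
  ohead (parr p) != Some (crease_loop u) -> sorted follows (crease_loop u :: parr p).
Proof.
have := composableP p; case: (parr p) => [//|b s] /= /andP[/eqP sb _] -> e nb.
rewrite andbT; apply: crease_follows => //; last exact: etrans sb e.
by apply: contra nb => cb; rewrite (crease_loop_src cb (etrans sb e)).
Qed.

Lemma ptgt_rcons p s b : parr p = rcons s b -> ptgt p = tgt b.
Proof. by move=> e; rewrite ptgt_parr e map_rcons last_rcons. Qed.

Lemma follows_loop_target p u : sorted follows (parr p) -> ptgt p = inr u ->
  ohead (rev (parr p)) != Some (crease_loop u) ->
  sorted follows (rcons (parr p) (crease_loop u)).
Proof.
case/lastP e: (parr p) => [//|s b]; rewrite rev_rcons (ptgt_rcons e) => srt tb nb.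
rewrite sorted_rcons2 srt; apply: follows_crease => //.
by apply: contra nb => cb; rewrite (crease_loop_tgt cb tb) /=.
Qed.

(** Loops are added at the ends that lie on a crease vertex and lack one. *)
Lemma saturation p : sorted follows (parr p) -> exists w, saturated w /\
  (size (parr p) <= size (parr w) <= size (parr p) + 2)%N.
Proof.
move=> srt.
have [w1 [srt1 src1 sz1]] : exists w, [/\ sorted follows (parr w),
    forall u, psrc w = inr u -> ohead (parr w) = Some (crease_loop u) &
    (size (parr p) <= size (parr w) <= size (parr p) + 1)%N].
  case sp: (psrc p) => [v|u].
    by exists p; split; rewrite ?leqnn ?leq_addr // => u; rewrite sp.
  have [h|h] := eqVneq (ohead (parr p)) (Some (crease_loop u)).
    by exists p; split; rewrite ?leqnn ?leq_addr // => u'; rewrite sp => -[<-].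
  have [w /pcatP[_ sw aw]] : exists w, is_cat (arrow_path (crease_loop u : arr Q)) p w.
    by apply: pcat_some; rewrite sp.
  exists w; split; rewrite ?aw /=.
  - exact: follows_loop_source.
  - by move=> u'; rewrite sw => -[<-].
  - by rewrite leqnSn addn1 leqnn.
case tp: (ptgt w1) => [v|u].
  exists w1; split; first by split => // u; rewrite tp.
  by case/andP: sz1 => -> /leq_trans->; rewrite // leq_add2l.
have [h|h] := eqVneq (ohead (rev (parr w1))) (Some (crease_loop u)).
  exists w1; split; first by split => // u'; rewrite tp => -[<-].
  by case/andP: sz1 => -> /leq_trans->; rewrite // leq_add2l.
have [w hw] : exists w, is_cat w1 (arrow_path (crease_loop u : arr Q)) w.
  by apply: pcat_some; rewrite tp.
have /pcatP[_ sw aw] := hw; exists w; rewrite /= in aw.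
have aw' : parr w = rcons (parr w1) (crease_loop u) by rewrite aw cats1.
split; first split.
- by rewrite aw'; apply: follows_loop_target.
- move=> u'; rewrite sw aw => e; have := src1 _ e.
  by case: (parr w1).
- by move=> u'; rewrite (ptgt_rcons aw') aw' rev_rcons => -[<-].
case/andP: sz1 => h1 h2.
by rewrite aw' size_rcons leqW //= -addn1 -[2%N]/(1 + 1)%N addnA leq_add2r.
Qed.

(** Saturated paths of distinct lengths are linearly independent in A, since the
    forms of these paths have a unitriangular matrix on them.  The saturations of
    the prefixes of a long reduced path would exceed the dimension of A. *)
Lemma reduced_bounded : finite_dimensional A ->
  exists N, forall p, sorted follows (parr p) -> (size (parr p) < N)%N.
Proof.
move=> [n [[f lf fbij]]].
(* Prefixes whose lengths differ by 3 have saturations of different lengths. *)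
exists (3 * n)%N => p srt; rewrite ltnNge; apply/negP => le.
have /boolp.choice[w hw] : forall k : 'I_n.+1, exists w, saturated w /\
    (3 * k <= size (parr w) <= 3 * k + 2)%N.
  move=> k; have lek : (3 * k <= size (parr p))%N.
    by rewrite (leq_trans _ le) // leq_mul2l -ltnS ltn_ord orbT.
  have [q [r [_ eq _]]] := split2 (esym (cat_take_drop (3 * k) (parr p))).
  have [|w [sw szw]] := @saturation q.
    by rewrite eq; move: srt; rewrite -{1}(cat_take_drop (3 * k) (parr p)) => /cat_sorted2[].
  by exists w; split=> //; move: szw; rewrite eq size_takel.
have /boolp.choice[d hd] : forall k, exists d : dual A,
    forall x, d (quot_proj _ x) = top_form (w k) x.
  by move=> k; apply: top_form_dual => //; case: (hw k).
pose e k : A := quot_proj (relations T) (pbasis K (w k)).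
pose G := \matrix_(k < n.+1, l < n.+1) (d l (e k) : K).
have szlt (k l : 'I_n.+1) : (k < l)%N -> (size (parr (w k)) < size (parr (w l)))%N.
  move=> kl; have [_ /andP[_ h1]] := hw k; have [_ /andP[h2 _]] := hw l.
  by apply: leq_ltn_trans h1 (leq_trans _ h2); rewrite -addnS -[X in (_ + X)%N]muln1 -mulnDr addn1 leq_mul2l.
have GE (k l : 'I_n.+1) : (k <= l)%N -> G k l = (k == l)%:R.
  move=> le_kl; rewrite mxE /e hd top_form_basis /top_coef.
  case: (eqVneq k l) => [->|ne]; first by rewrite !eqxx /= coef_size ?eqxx.
  have lt : (k < l)%N by rewrite ltn_neqAle ne.
  rewrite (coef_size _ (ltnW (szlt _ _ lt))).
  case: (parr (w k) =P _) => [e1|_]; last by case: ifP.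
  by have := szlt _ _ lt; rewrite e1 ltnn.
have Gu : G \in unitmx.
  rewrite unitmxE det_trig ?unitfE; last first.
    apply/is_trig_mxP => i j lt; rewrite GE ?(ltnW lt) //.
    by move: lt; rewrite ltn_neqAle => /andP[/negPf ne _]; rewrite -val_eqE /= ne.
  by rewrite prodf_seq_neq0; apply/allP => i _; rewrite GE ?leqnn // eqxx oner_neq0.
pose X := \matrix_(k < n.+1) f (e k).
have : row_free X.
  rewrite -kermx_eq0; apply/eqP/row_matrixP => i; rewrite row0.
  set c := row i _; have cX : c *m X = 0 by rewrite /c -row_mul mulmx_ker row0.
  pose F : {linear A -> 'rV[K]_n} := HB.pack f (GRing.isLinear.Build _ _ _ _ f lf).
  have ce0 : \sum_k c 0 k *: e k = 0.
    apply: (bij_inj fbij); rewrite -[f]/(F : _ -> _) linear_sum linear0.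
    rewrite -[RHS]cX mulmx_sum_row; apply: eq_bigr => k _.
    by rewrite linearZ rowK.
  suff cG : c *m G = 0 by rewrite -[c](mulmxK Gu) cG mul0mx.
  apply/rowP => l; rewrite !mxE.
  pose D : {linear A -> K^o} := HB.pack (d l : A -> K^o)
    (GRing.isLinear.Build _ _ _ _ (d l : A -> K^o) (dual_scalar (d l))).
  have := congr1 D ce0; rewrite linear_sum linear0; apply: etrans.
  by apply: eq_bigr => k _; rewrite linearZ [G k l]mxE.
rewrite /row_free => /eqP rX; have := rank_leq_col X.
by rewrite rX ltnn.
Qed.

End Bounded.

(** * Maximal paths *)

Section Maximal.
Variables (K : fieldType) (T : folded_triple K).
Hypothesis hT : folded_gentle T.
Local Notation Q := (fquiver T).
Local Notation A := (folded_algebra T).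
Local Notation follows := (@follows K T).
Local Notation coef := (@coef K T).
Implicit Types (a b c : arr Q) (s l r t : seq (arr Q)) (u : cvert T) (v : vert Q).
Implicit Types (p q m w : qpath Q).

Lemma maximal_head p a b s : maximal_path p -> parr p = b :: s -> ~~ follows a b.
Proof.
move=> [red mx] e; apply/negP => ab.
have [w hw] : exists w, is_cat (arrow_path a) p w.
  apply: pcat_some; rewrite ptgt_arrow; have /and3P[/eqP-> _ _] := ab.
  by have := composableP p; rewrite e => /andP[/eqP].
apply: (mx (arrow_path a) w) => //; first by left.
apply/(reduced_sorted hT); have /pcatP[_ _ ->] := hw.
by move/(reduced_sorted hT): red; rewrite e /= ab.
Qed.

Lemma maximal_last p b c s : maximal_path p -> parr p = rcons s b -> ~~ follows b c.
Proof.
move=> [red mx] e; apply/negP => bc.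
have [w hw] : exists w, is_cat p (arrow_path c) w.
  by apply: pcat_some; rewrite (ptgt_rcons e); have /and3P[/eqP-> _ _] := bc.
apply: (mx (arrow_path c) w) => //; first by right.
apply/(reduced_sorted hT); have /pcatP[_ _ ->] := hw.
by move/(reduced_sorted hT): red; rewrite e /= cats1 sorted_rcons2 bc andbT.
Qed.

Lemma maximal_saturated p : maximal_path p -> saturated p.
Proof.
move=> hp; have [/(reduced_sorted hT) srt mx] := hp; split=> // u e; apply/eqP.
  apply: contraT => h; have := follows_loop_source hT srt e h.
  have [w hw] : exists w, is_cat (arrow_path (crease_loop u : arr Q)) p w.
    by apply: pcat_some; rewrite e.
  have /pcatP[_ _ ew] := hw; rewrite -[_ :: _]ew => /(reduced_sorted hT).
  by apply: contraPT => _; apply: mx; last by left; apply: hw.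
apply: contraT => h; have := follows_loop_target hT srt e h.
have [w hw] : exists w, is_cat p (arrow_path (crease_loop u : arr Q)) w.
  by apply: pcat_some; rewrite e.
have /pcatP[_ _ ew] := hw; rewrite -cats1 -[_ ++ _]ew => /(reduced_sorted hT).
by apply: contraPT => _; apply: mx; last by right; apply: hw.
Qed.

Lemma maxpathP (p : maxpath T) : maximal_path p.
Proof. by case: p => p /= /asboolP. Qed.

Lemma maxpath_saturated (p : maxpath T) : saturated p.
Proof. exact/maximal_saturated/maxpathP. Qed.

Lemma maximal_extension N m :
  (forall p, sorted follows (parr p) -> (size (parr p) < N)%N) ->
  sorted follows (parr m) -> exists (p : maxpath T) p1 p3, is_cat3 p1 m p3 p.
Proof.
move=> bd; have [k] := ubnP (N - size (parr m)); elim: k m => // k IH m lek srt.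
have [mx|nmx] := pselect (maximal_path m).
  exists (MaxPath (asboolT mx)), (stationary (psrc m)), (stationary (ptgt m)).
  by apply/is_cat3P; split; rewrite //= cats0.
have [q [w [nq hw srtw]]] : exists q w,
    [/\ parr q != [::], is_cat q m w \/ is_cat m q w & sorted follows (parr w)].
  apply: contrapT => h; apply: nmx; split=> [|q w nq hw]; first exact/(reduced_sorted hT).
  by move/(reduced_sorted hT) => srtw; apply: h; exists q, w.
have szw : (size (parr m) < size (parr w))%N.
  by case: hw => /pcatP[_ _ ->]; rewrite size_cat -?addSn -?addnS ?leq_addl ?leq_addr //;
    case: (parr q) nq => //= x s _; rewrite ?addSn ?ltnS ?leq_addl // addnS ltnS leq_addr.
have [|p [p1 [p3 /is_cat3P[e1 e2 e3 e4]]]] := IH w _ srtw.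
  by apply: leq_trans (lek : (N - size (parr m) <= k)%N); rewrite ltn_sub2l ?bd.
exists p; case: hw => hw; have /pcatP[h1 h2 h3] := hw; have ht := ptgt_cat hw.
  have [p1' /[dup] h /pcatP[f1 f2 f3]] : exists p', is_cat p1 q p'.
    by apply: pcat_some; rewrite e1 h2.
  exists p1', p3; apply/is_cat3P; split; rewrite ?f2 -?ht //.
    by rewrite (ptgt_cat h).
  by rewrite e4 f3 h3 !catA.
have [p3' /[dup] h /pcatP[f1 f2 f3]] : exists p', is_cat q p3 p'.
  by apply: pcat_some; rewrite -ht.
exists p1, p3'; apply/is_cat3P; split; rewrite ?f2 -?h2 //.
by rewrite e4 f3 h3 !catA.
Qed.

Lemma chain_uniq (R : rel (arr Q)) x s t :
  (forall a b c, R a b -> R a c -> b = c) -> path R x s -> path R x t ->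
  (forall c, ~~ R (last x s) c) -> (forall c, ~~ R (last x t) c) -> s = t.
Proof.
move=> det; elim: s x t => [|b s IH] x [|c t] //=.
- by move=> _ /andP[xc _] /(_ c); rewrite xc.
- by move=> /andP[xb _] _ _ /(_ b); rewrite xb.
move=> /andP[xb hs] /andP[xc ht]; have ebc := det _ _ _ xb xc; subst c.
by move=> h1 h2; rewrite (IH b t).
Qed.

(** Successors and predecessors being unique, the extensions of a non-stationary
    path m to both sides are forced, and in a maximal path neither can stop early. *)
Lemma maximal_extension_uniq (p q : maxpath T) p1 q1 m p3 q3 : parr m != [::] ->
  is_cat3 p1 m p3 p -> is_cat3 q1 m q3 q -> [/\ p = q, p1 = q1 & p3 = q3].
Proof.
move=> nm hp hq; have /is_cat3P[e1 e2 e3 e4] := hp; have /is_cat3P[f1 f2 f3 f4] := hq.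
have [sp _ _] := maxpath_saturated p; have [sq _ _] := maxpath_saturated q.
rewrite e4 in sp; rewrite f4 in sq.
have a3 : parr p3 = parr q3.
  case/lastP em: (parr m) nm sp sq => [//|s x] _.
  rewrite !cat_rcons !catA => /cat_sorted2[_ sp] /cat_sorted2[_ sq].
  apply: (chain_uniq (follows_detr hT) (x := x)) => //.
  + move=> c; case/lastP ep: (parr p3) => [|t y] /=.
      by apply: (@maximal_last p _ _ (parr p1 ++ s) (maxpathP p));
        rewrite e4 em ep cats0 rcons_cat.
    by rewrite last_rcons; apply: (@maximal_last p _ _ (parr p1 ++ parr m ++ t) (maxpathP p)); rewrite e4 ep -!rcons_cat.
  + move=> c; case/lastP eq: (parr q3) => [|t y] /=.
      by apply: (@maximal_last q _ _ (parr q1 ++ s) (maxpathP q));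
        rewrite f4 em eq cats0 rcons_cat.
    by rewrite last_rcons; apply: (@maximal_last q _ _ (parr q1 ++ parr m ++ t) (maxpathP q)); rewrite f4 eq -!rcons_cat.
have a1 : parr p1 = parr q1.
  case em: (parr m) nm sp sq => [//|x s] _.
  rewrite -!cat_rcons => /cat_sorted2[+ _] /cat_sorted2[+ _].
  rewrite -[rcons (parr p1) _]revK -[rcons (parr q1) _]revK !rev_rcons !rev_sorted.
  move=> sp sq; apply: (can_inj revK).
  apply: (@chain_uniq (fun y z => follows z y) x) => //.
  + by move=> a b c h1 h2; apply: follows_detl h1 h2.
  + move=> c; case ep: (parr p1) => [|y t].
      by apply: (@maximal_head p c x (s ++ parr p3) (maxpathP p)); rewrite e4 ep em.
    rewrite rev_cons last_rcons.
    by apply: (@maximal_head p c y (t ++ x :: s ++ parr p3) (maxpathP p)); rewrite e4 ep em.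
  + move=> c; case eq: (parr q1) => [|y t].
      by apply: (@maximal_head q c x (s ++ parr q3) (maxpathP q)); rewrite f4 eq em.
    rewrite rev_cons last_rcons.
    by apply: (@maximal_head q c y (t ++ x :: s ++ parr q3) (maxpathP q)); rewrite f4 eq em.
have ep1 : p1 = q1 by apply: qpath_eq_tgt; rewrite // e1 f1.
have ep3 : p3 = q3 by apply: qpath_eq; rewrite // -e2 -f2.
split=> //; apply: val_inj; apply: qpath_eq; first by rewrite e3 f3 ep1.
by rewrite e4 f4 a1 a3.
Qed.

Lemma coef_loop1 p u l r : saturated p -> catrev l r = parr p ->
  reached (psrc p) l = inr u -> coef (crease_loop u :: r) l r = lam1 T u.
Proof.
move=> sp e ev; have := saturatedP hT sp e ev.
have tm : tame (catrev l r) by rewrite e; apply: follows_tame; case: sp.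
have nr s : (s == crease_loop u :: s) = false.
  by apply/negP => /eqP/(congr1 size)/= /n_Sn.
have [hl|hl] := boolP (ohead l == _); have [hr|hr] := boolP (ohead r == _) => // _.
  case: l hl e ev tm => // c l /eqP[->] _ _ tm.
  by rewrite coef_loopL // !coef_size // eqxx nr mulr1 mulr0 addr0.
case: r hr e tm => // c r /eqP[->] _ tm.
rewrite coef_loopR // coef_loopL ?(tame_loop (tame_catrevr tm)) //.
by rewrite !coef_size // eqxx nr mulr1 mulr0 addr0.
Qed.

(** The quadratic relation and the values at the exponents 0 and 1 determine the
    value at every power of the loop, for whichever path. *)
Lemma coef_loops p q u l r l' r' k : saturated p -> saturated q ->
  catrev l r = parr p -> catrev l' r' = parr q ->
  reached (psrc p) l = inr u -> reached (psrc q) l' = inr u ->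
  coef (nseq k (crease_loop u) ++ r) l r = coef (nseq k (crease_loop u) ++ r') l' r'.
Proof.
move=> sp sq ep eq vp vq.
suff [] : coef (nseq k (crease_loop u) ++ r) l r = coef (nseq k (crease_loop u) ++ r') l' r'
  /\ coef (nseq k.+1 (crease_loop u) ++ r) l r
     = coef (nseq k.+1 (crease_loop u) ++ r') l' r' by [].
elim: k => [|k [IH1 IH2]]; split => //.
- by rewrite !coef_size // !eqxx.
- by rewrite (coef_loop1 sp ep vp) (coef_loop1 sq eq vq).
rewrite (coef_crease0 hT _ sp ep vp) (coef_crease0 hT _ sq eq vq).
by rewrite -!cat_cons IH1 -/(nseq k.+1 _) IH2.
Qed.

Lemma composable_loops v s : composable v s -> count_ordinary s = 0%N ->
  s = [::] \/ exists2 u, v = inr u & s = nseq (size s) (crease_loop u).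
Proof.
elim: s v => [|a s IH] v; first by left.
rewrite /= => /andP[/eqP sa cs] /eqP; rewrite addn_eq0 eqb0 negbK => /andP[ca /eqP ns].
right; case: a ca sa cs => // u _ /= <- cs; exists u => //.
by have [->|[u' [<-] es]] := IH _ cs ns; [|rewrite {1}es].
Qed.

(** The forms p3 p^* p1 and q3 q^* q1 of a commutativity relation agree.  For a
    non-stationary m there is only one decomposition.  For a stationary m the
    grading leaves only m and, at a crease vertex, the powers of the loop, where the
    value depends on the exponent alone. *)
Lemma top_form_comm (p q : maxpath T) p1 q1 m p3 q3 (b : qpath Q) :
  is_cat3 p1 m p3 p -> is_cat3 q1 m q3 q ->
  top_form p (pbasis K p1 ** pbasis K b ** pbasis K p3) =
  top_form q (pbasis K q1 ** pbasis K b ** pbasis K q3).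
Proof.
have [em|nm] := eqVneq (parr m) [::]; last first.
  by move=> hp hq; have [-> -> ->] := maximal_extension_uniq nm hp hq.
move=> hp hq; have /is_cat3P[e1 e2 e3 e4] := hp; have /is_cat3P[f1 f2 f3 f4] := hq.
have tm : ptgt m = psrc m by rewrite ptgt_parr em.
rewrite em /= in e4 f4.
have [[w' hw' E']|[nw' E']] := pbasis_mul3 K q1 b q3; last first.
  have [[w /is_cat3P[h1 h2 _ _] _]|[_ E]] := pbasis_mul3 K p1 b p3.
    by case: nw'; rewrite f1 -e1 h1 h2 -e2 f2.
  apply: etrans (f_equal (top_form p) E) (etrans _ (esym (f_equal (top_form q) E'))).
  exact: etrans (linear0 (top_form p)) (esym (linear0 (top_form q))).
have [[w hw E]|[[]]] := pbasis_mul3 K p1 b p3; last first.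
  by have /is_cat3P[<- ->] := hw'; rewrite e1 f1 -e2 f2.
apply: etrans (f_equal (top_form p) E) (etrans _ (esym (f_equal (top_form q) E'))).
apply: etrans (top_form_basis p w) (etrans _ (esym (top_form_basis q w'))).
rewrite /top_coef.
have /is_cat3P[g1 g2 -> ->] := hw; have /is_cat3P[_ _ -> ->] := hw'.
rewrite (is_cat3_tgt hw) (is_cat3_tgt hw') (is_cat3_tgt hp) (is_cat3_tgt hq) e3 f3 !eqxx /=.
have sp := maxpath_saturated p; have sq := maxpath_saturated q.
have tp : tame (parr p1 ++ parr p3) by rewrite -e4; apply: follows_tame; case: sp.
have tq : tame (parr q1 ++ parr q3) by rewrite -f4; apply: follows_tame; case: sq.
rewrite e4 f4 !coef_cat ?andbF //; [|by case/cat_sorted2: tq|by case/cat_sorted2: tp].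
have [nb|nb] := eqVneq (count_ordinary (parr b)) 0%N; last first.
  have z l r : coef (parr b ++ r) l r = 0.
    apply: contraNeq nb => /coef_count_ordinary /eqP.
    by rewrite /count_ordinary count_cat -[X in _ == X]add0n eqn_add2r.
  by rewrite !z.
have vb : psrc b = psrc m by rewrite -g1 e1.
have cb := composableP b.
have [->|[u vu ->]] := composable_loops cb nb.
  by rewrite !coef_size // !eqxx.
have rch v s : last v (map (@tgt Q) s) = reached v (catrev s [::]).
  by case/lastP: s => [//|s x]; rewrite map_rcons last_rcons -[catrev _ _]/(rev _) rev_rcons.
apply: (coef_loops _ sp sq) => //.
- by rewrite catrevE -/(rev _) revK e4.
- by rewrite catrevE -/(rev _) revK f4.
- by rewrite -rch e3 -/(ptgt p1) e1 -vb.
- by rewrite -rch f3 -/(ptgt q1) f1 -vb.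
Qed.

(** The form is q p^* r.  By [coef_prefix] r is a beginning of p and by [coef_suffix]
    q is an end of p; the exception in the latter is an overlap in a crease loop. *)
Lemma top_form_neq0 p q (r b : qpath Q) : saturated p -> tame (parr q) -> tame (parr r) ->
  top_form p (pbasis K r ** pbasis K b ** pbasis K q) != 0 ->
  (exists m, is_cat3 r m q p) \/
  (exists u r' (q' : seq (arr Q)), [/\ parr r = rcons r' (crease_loop u),
     parr q = crease_loop u :: q',
     parr p = r' ++ crease_loop u :: q', psrc r = psrc p & ptgt q = ptgt p]).
Proof.
move=> sp tq tr; have [[w hw E]|[_ E]] := pbasis_mul3 K r b q; last first.
  by move/eqP=> []; apply: etrans (f_equal (top_form p) E) (linear0 (top_form p)).
have {E} -> := etrans (f_equal (top_form p) E) (top_form_basis p w).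
have /is_cat3P[_ _ sw ew] := hw; have tw := is_cat3_tgt hw.
rewrite /top_coef sw tw.
case: andP => [[/eqP sr /eqP tgq]|_]; last by rewrite eqxx.
rewrite ew => nz.
have [|x ep] := coef_prefix tr _ nz; first by rewrite andbF.
have tp : tame (parr p) by apply: follows_tame; case: sp.
move: nz; rewrite ep coef_cat ?andbF // => /coef_suffix[] //.
- by rewrite catrevE -/(rev _) revK -ep.
- move=> [m em]; left.
  have [r0 [m0 [q0 [h er emm eq]]]] := split3 (etrans ep (f_equal (cat (parr r)) em)).
  exists m0; have -> : r = r0 by apply: qpath_eq; rewrite // sr; have /is_cat3P[] := h.
  by have -> : q = q0 by apply: qpath_eq_tgt; rewrite // tgq (is_cat3_tgt h).
- move=> [u [l [el eq]]]; right; exists u, (rev l), x; split=> //.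
  + by rewrite -rev_cons -el -[catrev _ _]/(rev _) revK.
  + by rewrite -cat_rcons -rev_cons -el -[catrev _ _]/(rev _) revK.
Qed.

(** Decreasing lengths make the matrix of forms below triangular. *)
Lemma reduced_enum N :
  (forall p, sorted follows (parr p) -> (size (parr p) < N)%N) ->
  exists S : seq (qpath Q), [/\ uniq S,
    sorted (fun p q => (size (parr q) <= size (parr p))%N) S &
    forall p, (p \in S) = sorted follows (parr p)].
Proof.
move=> bd; pose W := flatten [seq [seq (tval x : seq (arr Q)) | x <- enum {: k.-tuple (farr T)}]
  | k <- iota 0 N].
have WP s : (size s < N)%N -> s \in W.
  move=> lt; apply/flatten_mapP; exists (size s); first by rewrite mem_iota.
  by apply/mapP; exists (in_tuple s); rewrite ?mem_enum.
pose S0 : seq (qpath Q) := pmap insub [seq ((v : vert Q), s) | v <- enum (fvert T), s <- W].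
exists (sort (fun p q => (size (parr q) <= size (parr p))%N)
  (undup [seq p <- S0 | sorted follows (parr p)])); split.
- by rewrite sort_uniq undup_uniq.
- by apply: sort_sorted => p q; apply: leq_total.
move=> p; rewrite mem_sort mem_undup mem_filter andb_idr // => /bd lt.
rewrite mem_pmap_sub; apply/allpairsP; exists (psrc p, parr p); split=> /=.
- by rewrite mem_enum.
- exact: WP.
- by case: (p) => [[]].
Qed.

End Maximal.

(** * The repetitive algebra *)

Section RepetitiveAlgebra.
Variables (K : fieldType) (A : nualgType K).
Implicit Types (a b : A) (f g : dual A) (i j : int).

Definition rep_inA i a : repalg A := << ((a, 0) : A * dual A) *g i >>.
Definition rep_inD i f : repalg A := << ((0, f) : A * dual A) *g i >>.

Lemma rep_inAE i a k : (rep_inA i a)@_k = if k == i then (a, 0) else 0.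
Proof. by rewrite /rep_inA mcoeffU eq_sym; case: eqP. Qed.

Lemma rep_inDE i f k : (rep_inD i f)@_k = if k == i then (0, f) else 0.
Proof. by rewrite /rep_inD mcoeffU eq_sym; case: eqP. Qed.

Lemma dual_lact0r a : dual_lact a (0 : dual A) = 0.
Proof. by apply: dualP. Qed.

Lemma dual_ract0l a : dual_ract (0 : dual A) a = 0.
Proof. by apply: dualP. Qed.

Lemma dual_lact0l f : dual_lact 0 f = 0.
Proof. by apply: dualP => b; rewrite dual_lactE numulr0 dual_f0. Qed.

Lemma dual_ract0r f : dual_ract f 0 = 0.
Proof. by apply: dualP => b; rewrite dual_ractE numul0r dual_f0. Qed.

Lemma rep_inA_linear i : linear (rep_inA i).
Proof.
move=> c a b; apply/malgP => k.
rewrite mcoeffD [X in _ = X + _]rep_scaleE !rep_inAE; case: eqP => _; last by rewrite scaler0 addr0.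
by congr pair; rewrite /= scaler0 addr0.
Qed.

Lemma rep_inD_linear i : linear (rep_inD i).
Proof.
move=> c a b; apply/malgP => k.
rewrite mcoeffD [X in _ = X + _]rep_scaleE !rep_inDE; case: eqP => _; last by rewrite scaler0 addr0.
by congr pair; rewrite /= scaler0 addr0.
Qed.

HB.instance Definition _ i :=
  GRing.isLinear.Build K A (repalg A) *:%R (rep_inA i) (rep_inA_linear i).
HB.instance Definition _ i :=
  GRing.isLinear.Build K (dual A) (repalg A) *:%R (rep_inD i) (rep_inD_linear i).

Lemma rep_inAA i j a b :
  rep_inA i a ** rep_inA j b = if i == j then rep_inA i (a ** b) else 0.
Proof.
apply/malgP => k; rewrite [LHS]rep_mulE !rep_inAE.
have [->|ki] := eqVneq k i.
  case: (eqVneq i j) => [_|ij] /=; rewrite ?rep_inAE ?eqxx ?mcoeff0 /=.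
    by rewrite dual_lact0r dual_ract0l addr0.
  by rewrite numulr0 dual_lact0r dual_ract0l addr0.
rewrite /= numul0r dual_lact0l dual_ract0l addr0.
by case: eqP => _; rewrite ?rep_inAE ?(negPf ki) ?mcoeff0.
Qed.

Lemma rep_inAD i j a f :
  rep_inA i a ** rep_inD j f = if i == j then rep_inD i (dual_lact a f) else 0.
Proof.
apply/malgP => k; rewrite [LHS]rep_mulE !rep_inAE !rep_inDE.
have [->|ki] := eqVneq k i.
  case: (eqVneq i j) => [_|ij] /=; rewrite ?rep_inDE ?eqxx ?mcoeff0 /=.
    by rewrite numulr0 dual_ract0l addr0.
  by rewrite numulr0 dual_lact0r dual_ract0l addr0.
rewrite /= numul0r dual_lact0l dual_ract0l addr0.
by case: eqP => _; rewrite ?rep_inDE ?(negPf ki) ?mcoeff0.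
Qed.

Lemma rep_inDA i j f b :
  rep_inD i f ** rep_inA j b = if j == i - 1 then rep_inD i (dual_ract f b) else 0.
Proof.
apply/malgP => k; rewrite [LHS]rep_mulE !rep_inAE !rep_inDE.
have [->|ki] := eqVneq k i.
  rewrite [_ == j]eq_sym; case: (eqVneq j (i - 1)) => [_|ij] /=;
    rewrite ?rep_inDE ?eqxx ?mcoeff0 /=.
    by rewrite numul0r dual_lact0l add0r.
  by rewrite numul0r dual_lact0l dual_ract0r addr0.
rewrite /= numul0r dual_lact0l dual_ract0l addr0.
by case: (j == _); rewrite ?rep_inDE ?(negPf ki) ?mcoeff0.
Qed.

Lemma rep_inDD i j f g : rep_inD i f ** rep_inD j g = 0.
Proof.
apply/malgP => k; rewrite [LHS]rep_mulE mcoeff0 !rep_inDE.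
have h l i' (f' : dual A) : ((if l == i' then (0, f') else 0) : A * dual A).1 = 0.
  by case: eqP.
by rewrite !h numul0r dual_lact0l dual_ract0r addr0.
Qed.

End RepetitiveAlgebra.

(** * Copies of Q in Q_R *)

Section CopyHom.
Variables (K : fieldType) (T : folded_triple K).
Local Notation Q := (fquiver T).
Local Notation QR := (rquiver T).
Implicit Types (p q r m : qpath Q) (w : qpath QR) (i : int).

Lemma ptgt_copy i p : ptgt (copy i p) = (ptgt p, i).
Proof.
by rewrite !ptgt_parr /= -map_comp -(last_map (fun v => (v, i))) -map_comp.
Qed.

Lemma copy_cat i p q r : is_cat p q r -> is_cat (copy i p) (copy i q) (copy i r).
Proof.
move=> /pcatP[e1 e2 e3]; apply/pcatP; rewrite ptgt_copy; split.
- by rewrite e1.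
- by rewrite /psrc /= -/(psrc r) e2.
- by rewrite /parr /= -!/(parr _) e3 map_cat.
Qed.

Lemma copy_arrow i (a : arr Q) : copy i (arrow_path a) = arrow_path (copy_arr i a).
Proof. by apply: qpath_eq. Qed.

Lemma copy_stationary i (v : vert Q) :
  copy i (stationary v) = stationary ((v, i) : vert QR).
Proof. by apply: qpath_eq. Qed.

Definition copy_hom i : {linear pathalg K Q -> pathalg K QR} :=
  path_hom (fun v : vert Q => pbasis K (stationary ((v, i) : vert QR)))
           (fun a : arr Q => pbasis K (arrow_path (copy_arr i a))).

Lemma copy_homM i : {morph copy_hom i : x y / x ** y}.
Proof.
apply: path_homM => [v w|a].
- have [<-|ne] := eqVneq v w.
    by apply: (@pbasis_srcM QR K (stationary ((v, i) : vert QR))).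
  by apply: pbasis_ncat => -[/eqP]; rewrite (negPf ne).
- exact: (@pbasis_tgtM QR K (arrow_path (copy_arr i a))).
Qed.

Lemma copy_hom_basis i p : copy_hom i (pbasis K p) = pbasis K (copy i p).
Proof.
apply: etrans (path_hom_basis _ _ _) _.
elim/qpath_ind_rcons: p => [v|p a r IH c]; first by rewrite copy_stationary.
apply: etrans (path_image_rcons _ _ c) _; rewrite IH.
by rewrite (pbasis_cat K (copy_cat i c)) copy_arrow.
Qed.

Lemma copy_hom_crease u i : copy_hom i (crease_rel u) = rep_crease_rel u i.
Proof.
have e1 : copy_hom i (pbasis K (arrow_path (crease_loop u))) =
    pbasis K (arrow_path (copy_arr i (crease_loop u))).
  by rewrite copy_hom_basis copy_arrow.
apply: etrans (linear_quadratic (copy_hom i) _ _ _ _ _) _.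
exact: (f_equal3 (fun x y z => x - lam1 T u *: y - lam2 T u *: z)
  (etrans (copy_homM i _ _) (f_equal2 numul e1 e1)) e1 (copy_hom_basis i _)).
Qed.

Lemma copy_ideal i x : ideal_gen (relations T) x ->
  ideal_gen (rep_relations T) (copy_hom i x).
Proof.
move=> Ix; apply: (Ix (copy_hom i @^-1` ideal_gen (rep_relations T))%classic).
  by apply: ideal_preim; [apply: copy_homM|apply: ideal_gen_ideal].
move=> _ [[z hz <-]|[u _ <-]] /=; apply: ideal_genS.
  by rewrite copy_hom_basis; left; left; left; exists z, i.
by rewrite copy_hom_crease; left; left; right; exists u, i.
Qed.

Lemma around_ends q (p : maxpath T) r i w : around q p r i w ->
  ptgt q = ptgt p /\ psrc r = psrc p.
Proof.
by move=> /is_cat3P[]; rewrite ptgt_copy ptgt_arrow /= => -[->] [<-].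
Qed.

Lemma around_parr q (p : maxpath T) r i w : around q p r i w ->
  parr w = map (copy_arr i) (parr q) ++ chi p i :: map (copy_arr (i - 1)) (parr r).
Proof. by move=> /is_cat3P[_ _ _ ->]. Qed.

Lemma around_ex q (p : maxpath T) r i : ptgt q = ptgt p -> psrc r = psrc p ->
  exists w, around q p r i w.
Proof.
move=> e1 e2; apply: is_cat3_ex; first by rewrite ptgt_copy e1.
by rewrite ptgt_arrow /= -e2.
Qed.

Lemma copy_nconnecting i p : has (@is_connecting K T) (parr (copy i p)) = false.
Proof. by rewrite /parr /= -/(parr p); apply/negbTE; rewrite has_map; elim: (parr p). Qed.

End CopyHom.

(** * The homomorphism from K Q_R to the repetitive algebra *)

Lemma eq_split_first (X : eqType) (P : pred X) s1 x s2 t1 y t2 :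
  ~~ has P s1 -> ~~ has P t1 -> P x -> P y -> s1 ++ x :: s2 = t1 ++ y :: t2 ->
  [/\ s1 = t1, x = y & s2 = t2].
Proof.
move=> n1 n2 px py e; have := congr1 (find P) e.
rewrite !find_cat (negPf n1) (negPf n2) /= px py !addn0 => sz.
by move/eqP: e; rewrite eqseq_cat // eqseq_cons => /and3P[/eqP-> /eqP-> /eqP->].
Qed.

Lemma map_suffix (X Y : eqType) (f : X -> Y) u s t : injective f ->
  u ++ map f s = map f t -> exists s', t = s' ++ s.
Proof.
move=> injf; elim: u t => [|a u IH] [|b t] /=.
- by case: s => // _; exists [::].
- by move=> e; exists [::]; apply: (inj_map injf); rewrite e.
- by [].
by move=> [_ /IH[s' ->]]; exists (b :: s').
Qed.

Lemma map_prefix (X Y : eqType) (f : X -> Y) u s t : injective f ->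
  map f s ++ u = map f t -> exists s', t = s ++ s'.
Proof.
move=> injf; elim: s t => [|a s IH] [|b t] //=; try by eexists.
by move=> [/injf<- /IH[s' ->]]; exists s'.
Qed.

(** The computation behind [overlap_full], with e the crease loop, s its vertex and
    w, w1, w2, w3 the four paths with or without the loop at the two ends. *)
Lemma overlap_combination (K : fieldType) (A : nualgType K) (I : set A)
    (e s w w1 w2 w3 : A) (c d : K) : two_sided_ideal I ->
  w = e ** w2 -> w1 = e ** w3 -> s ** w3 = w3 ->
  I (w1 - w2) -> I (e ** e - c *: e - d *: s) -> I (w - (c *: w1 + d *: w3)).
Proof.
move=> hI -> e1 s3 I1 I2; have [_ IL Il Ir] := hI.
have -> : e ** w2 - (c *: w1 + d *: w3) =
    (-1) *: (e ** (w1 - w2)) + (e ** e - c *: e - d *: s) ** w3.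
  rewrite numulrB !numulBr !numulZl s3 -numulA -e1 scaleN1r opprB opprD !addrA.
  by rewrite subrK.
by apply: IL; [apply: Il|apply: Ir].
Qed.

Section Phi.
Variables (K : fieldType) (T : folded_triple K).
Hypothesis hT : folded_gentle T.
Local Notation Q := (fquiver T).
Local Notation QR := (rquiver T).
Local Notation A := (folded_algebra T).
Local Notation cls x := (quot_proj (relations T) x).
(** The forms p^* on A. *)
Variable delta : maxpath T -> dual A.
Hypothesis deltaE : forall p x, delta p (cls x) = top_form p x.
Implicit Types (p q r m : qpath Q) (w : qpath QR) (i : int).

Definition rep_vertex (v : vert QR) : repalg A :=
  rep_inA v.2 (cls (pbasis K (stationary v.1))).

Definition rep_arrow (a : arr QR) : repalg A :=
  match a with
  | inl (b, i) => rep_inA i (cls (pbasis K (arrow_path b)))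
  | inr (p, i) => rep_inD i (delta p)
  end.

Definition rep_hom : {linear pathalg K QR -> repalg A} := path_hom rep_vertex rep_arrow.

Lemma top_form_tgt (p : maxpath T) b :
  top_form p (pbasis K b ** pbasis K (stationary (ptgt p))) = top_form p (pbasis K b).
Proof.
have [e|ne] := eqVneq (ptgt b) (ptgt p).
  by congr (top_form p _); rewrite -e; apply: pbasis_tgtM.
have E : pbasis K b ** pbasis K (stationary (ptgt p)) = 0.
  by apply: pbasis_ncat; apply/eqP.
apply: etrans (f_equal (top_form p) E) _; apply: etrans (linear0 (top_form p)) _.
by apply: esym; apply: etrans (top_form_basis p b) _; rewrite /top_coef (negPf ne) andbF.
Qed.

Lemma top_form_src (p : maxpath T) b :
  top_form p (pbasis K (stationary (psrc p)) ** pbasis K b) = top_form p (pbasis K b).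
Proof.
have [e|ne] := eqVneq (psrc b) (psrc p).
  by congr (top_form p _); rewrite -e; apply: pbasis_srcM.
have E : pbasis K (stationary (psrc p)) ** pbasis K b = 0.
  by apply: pbasis_ncat; apply/eqP; rewrite eq_sym.
apply: etrans (f_equal (top_form p) E) _; apply: etrans (linear0 (top_form p)) _.
by apply: esym; apply: etrans (top_form_basis p b) _; rewrite /top_coef (negPf ne).
Qed.

Lemma rep_vertexM (v w : vert QR) : rep_vertex v ** rep_vertex w = if v == w then rep_vertex v else 0.
Proof.
case: v w => [v i] [w j]; apply: etrans (rep_inAA _ _ _ _) _ => /=.
rewrite -quot_projM -pair_eqE /=.
have [<-|ne] := eqVneq v w.
  by case: eqP => //= _; congr (rep_inA _ (cls _)); apply: (@pbasis_srcM Q K (stationary v)).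
have -> : pbasis K (stationary v) ** pbasis K (stationary w) = 0.
  by apply: pbasis_ncat; apply/eqP.
by rewrite !linear0 if_same.
Qed.

Lemma rep_vertex_arrow (a : arr QR) : rep_vertex (src a) ** rep_arrow a = rep_arrow a.
Proof.
case: a => [[b i]|[p i]] /=.
  apply: etrans (rep_inAA _ _ _ _) _; rewrite eqxx -quot_projM.
  by congr (rep_inA _ (cls _)); apply: (@pbasis_srcM Q K (arrow_path b)).
apply: etrans (rep_inAD _ _ _ _) _; rewrite eqxx; congr rep_inD.
apply: dual_quot_ext => b; rewrite dual_lactE -quot_projM !deltaE.
exact: top_form_tgt.
Qed.

Lemma rep_arrow_vertex (a : arr QR) : rep_arrow a ** rep_vertex (tgt a) = rep_arrow a.
Proof.
case: a => [[b i]|[p i]] /=.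
  apply: etrans (rep_inAA _ _ _ _) _; rewrite eqxx -quot_projM.
  by congr (rep_inA _ (cls _)); apply: (@pbasis_tgtM Q K (arrow_path b)).
apply: etrans (rep_inDA _ _ _ _) _; rewrite eqxx; congr rep_inD.
apply: dual_quot_ext => b; rewrite dual_ractE -quot_projM !deltaE.
exact: top_form_src.
Qed.

Lemma rep_homM : {morph rep_hom : x y / x ** y}.
Proof. by apply: path_homM; [apply: rep_vertexM|apply: rep_arrow_vertex]. Qed.

Lemma rep_hom_arrow (a : arr QR) : rep_hom (pbasis K (arrow_path a)) = rep_arrow a.
Proof. by apply: path_hom_arrow; apply: rep_vertex_arrow. Qed.

Lemma rep_hom_copy i p : rep_hom (pbasis K (copy i p)) = rep_inA i (cls (pbasis K p)).
Proof.
elim/qpath_ind_rcons: p => [v|p a r IH c].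
  rewrite copy_stationary; exact: (path_hom_stationary rep_vertex rep_arrow).
apply: etrans (f_equal rep_hom (pbasis_cat K (copy_cat i c))) _.
rewrite copy_arrow; apply: etrans (rep_homM _ _) _.
apply: etrans (f_equal2 numul IH (rep_hom_arrow _)) _.
apply: etrans (rep_inAA _ _ _ _) _; rewrite eqxx -quot_projM.
by congr (rep_inA _ (cls _)); apply: esym; apply: pbasis_cat.
Qed.

(** The form p3 p^* p1, to which the path p3 chi_p p1 is sent. *)
Definition pairing (p : maxpath T) p1 p3 : dual A :=
  dual_ract (dual_lact (cls (pbasis K p3)) (delta p)) (cls (pbasis K p1)).

Lemma pairingE (p : maxpath T) p1 p3 b : pairing p p1 p3 (cls (pbasis K b)) =
  top_form p (pbasis K p1 ** pbasis K b ** pbasis K p3).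
Proof.
rewrite /pairing dual_ractE dual_lactE.
exact: etrans (f_equal (delta p) (esym (quot_projM3 _ _ _ _))) (deltaE p _).
Qed.

Lemma rep_hom_around p3 (p : maxpath T) p1 i w : around p3 p p1 i w ->
  rep_hom (pbasis K w) = rep_inD i (pairing p p1 p3).
Proof.
move=> h; apply: etrans (f_equal rep_hom (pbasis_cat3 K h)) _.
apply: etrans (rep_homM _ _) _; apply: etrans (f_equal2 numul (rep_homM _ _) erefl) _.
apply: etrans (f_equal2 numul (f_equal2 numul (rep_hom_copy i p3)
  (rep_hom_arrow (chi p i))) (rep_hom_copy (i - 1) p1)) _.
apply: etrans (f_equal2 numul (rep_inAD _ _ _ _) erefl) _; rewrite eqxx.
by apply: etrans (rep_inDA _ _ _ _) _; rewrite eqxx.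
Qed.

Lemma count_copy i (s : seq (arr Q)) : count (@is_connecting K T) (map (copy_arr i) s) = 0%N.
Proof. by elim: s. Qed.

(** Two connecting arrows give 0, as the product of two elements of DA is 0. *)
Lemma rep_path_cases w :
  [\/ exists i q, w = copy i q,
      exists q (p : maxpath T) r i, around q p r i w |
      (2 <= count (@is_connecting K T) (parr w))%N /\ rep_hom (pbasis K w) = 0].
Proof.
elim/qpath_ind_rcons: w => [[v i]|w a w' IH c].
  by apply: Or31; exists i, (stationary v); rewrite copy_stationary.
have /pcatP[e1 e2 e3] := c.
have ec : count (@is_connecting K T) (parr w') =
    (count (@is_connecting K T) (parr w) + is_connecting a)%N.
  by rewrite e3 count_cat /= addn0.
have eh : rep_hom (pbasis K w') = rep_hom (pbasis K w) ** rep_arrow a.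
  apply: etrans (f_equal rep_hom (pbasis_cat K c)) (etrans (rep_homM _ _) _).
  by congr (_ ** _); apply: rep_hom_arrow.
case: IH => [[i [q ew]]|[q [p [r [i hw]]]]|[cw hw]].
- move: e1; rewrite ew ptgt_copy; case: a c e3 ec eh => [[b j]|[p j]] c e3 ec eh [eq ei].
    apply: Or31; rewrite -ei in e3; exists i.
    have [r hr] : exists r, is_cat q (arrow_path b) r by apply: pcat_some.
    exists r; have := copy_cat i hr; rewrite copy_arrow -ew => hr'.
    by apply: is_cat_fun c _; rewrite -ei.
  apply: Or32; exists q, p, (stationary (psrc p)), j; rewrite ew -ei in c.
  exists w'; rewrite -?ei //.
  by apply/pcatP; rewrite (ptgt_cat c) ptgt_arrow /= cats0.
- have [eq er] := around_ends hw.
  have tw := is_cat3_tgt hw; rewrite ptgt_copy in tw.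
  move: e1; rewrite tw; case: a c e3 ec eh => [[b j]|[p' j]] c e3 ec eh [eb ei].
    apply: Or32.
    have [r' hr] : exists r', is_cat r (arrow_path b) r' by apply: pcat_some.
    exists q, p, r', i; have /pcatP[_ h2 h3] := hr.
    apply/is_cat3P; split; rewrite ?ptgt_copy ?ptgt_arrow ?eq //=.
    + by rewrite /psrc /= -/(psrc r') h2 er.
    + by rewrite e2; have /is_cat3P[_ _ ->] := hw.
    + rewrite e3 (around_parr hw) /= -catA; congr (_ ++ (_ :: _)).
      by rewrite /parr /= -!/(parr _) h3 map_cat ei.
  apply: Or33; split; first by rewrite ec (around_parr hw) count_cat /= !count_copy.
  apply: etrans eh (etrans (f_equal2 numul (rep_hom_around hw) erefl) _).
  exact: rep_inDD.
apply: Or33; split; first by rewrite ec (leq_trans cw) ?leq_addr.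
apply: etrans eh (etrans (f_equal2 numul hw erefl) _); exact: numul0r.
Qed.


Lemma copy_arr_inj i : injective (@copy_arr K T i).
Proof. by move=> a b [->]. Qed.

Lemma around_full q (p : maxpath T) r i w m : around q p r i w -> is_cat3 r m q p ->
  full_subpath w.
Proof.
move=> hw /is_cat3P[e1 e2 e3 e4].
have [mq hmq] := pcat_some e2; have /pcatP[_ sq aq] := hmq; have tq := ptgt_cat hmq.
have tw := is_cat3_tgt hw; have /is_cat3P[_ _ sw _] := hw.
have [f hf] : exists f, around mq p r i f.
  by apply: around_ex; rewrite ?tq; have [] := around_ends hw.
exists f.
  exists p, r, mq, i; split=> //; apply/pcatP; split; rewrite ?sq //.
  by rewrite e4 aq.
exists (copy i m), (stationary (ptgt w)); apply/is_cat3P; split=> //.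
- by rewrite ptgt_copy e2 sw.
- by have /is_cat3P[_ _ -> _] := hf; rewrite /psrc /= -!/(psrc _) sq.
by rewrite (around_parr hf) (around_parr hw) cats0 aq {3}/parr /= -!/(parr _) map_cat -catA.
Qed.

Lemma full_subpath_cases w : full_subpath w ->
  (exists i q, w = copy i q) \/
  (exists p3 (p : maxpath T) p1 i m, around p3 p p1 i w /\ is_cat3 p1 m p3 p).
Proof.
move=> [f [p [p1 [p2 [i [hp hf]]]]] [x [y /is_cat3P[_ _ _ ef]]]].
have cf : count (@is_connecting K T) (parr f) = 1%N.
  by rewrite (around_parr hf) count_cat /= !count_copy.
have [|[q [p' [r [i' hw]]]]|[cw _]] := rep_path_cases w; first by left.
  right; rewrite (around_parr hw) in ef.
  have cx : count (@is_connecting K T) (parr x) = 0%N.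
    move: cf; rewrite ef !count_cat /= !count_copy.
    by case: (count _ (parr x)) => // n; rewrite addSn addnS.
  have e : (parr x ++ map (copy_arr i') (parr q)) ++
      chi p' i' :: (map (copy_arr (i' - 1)) (parr r) ++ parr y) =
      map (copy_arr i) (parr p2) ++ chi p i :: map (copy_arr (i - 1)) (parr p1).
    by rewrite -(around_parr hf) ef -!catA.
  have [||//|//|eL eC eR] := @eq_split_first _ (@is_connecting K T) _ _ _ _ _ _ _ _ _ _ e.
  - by rewrite has_count count_cat cx count_copy.
  - by rewrite has_count count_copy.
  case: eC eL eR => ? ?; subst p' i'.
  move=> /(map_suffix (@copy_arr_inj _))[s2 e2] /(map_prefix (@copy_arr_inj _))[s1 e1].
  have /pcatP[g1 g2 g3] := hp; have [h1 h2] := around_ends hw.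
  have [r0 [m [q0 [h er em eq]]]] : exists r0 m q0,
      [/\ is_cat3 r0 m q0 p, parr r0 = parr r, parr m = s1 ++ s2 & parr q0 = parr q].
    by apply: split3; rewrite g3 e1 e2 -!catA.
  exists q, p, r, i, m; split=> //.
  have -> : r = r0 by apply: qpath_eq; rewrite // h2; have /is_cat3P[] := h.
  by have -> : q = q0 by apply: qpath_eq_tgt; rewrite // h1 (is_cat3_tgt h).
by move: cf; rewrite ef !count_cat; case: count cw => [|[|n]] //= _; rewrite addnCA.
Qed.


Lemma not_tame_split v (s : seq (arr Q)) : composable v s -> ~~ tame s ->
  exists s1 u s2, s = s1 ++ [:: crease_loop u; crease_loop u] ++ s2.
Proof.
elim: s v => [//|a s IH] v /= /andP[_ cs]; rewrite tame_cons negb_and negbK.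
case/orP => [/andP[ca]|nt]; last first.
  by have [s1 [u [s2 ->]]] := IH _ cs nt; exists (a :: s1), u, s2.
case: s cs {IH} => [//|b s] /= /andP[/eqP sb _] cb.
case: a ca sb => // u _ sb; exists [::], u, s.
by rewrite /= (crease_loop_src cb sb).
Qed.

Lemma no_square_tame i p w s1 s2 : (forall q : qpath QR, subpath q w -> ~ rep_crease_square q) ->
  parr w = s1 ++ map (copy_arr i) (parr p) ++ s2 -> tame (parr p).
Proof.
move=> ns ew; apply: contraT => nt; have [t1 [u [t2 et]]] :=
  not_tame_split (composableP p) nt.
have {}ew : parr w = (s1 ++ map (copy_arr i) t1) ++
    [:: copy_arr i (crease_loop u); copy_arr i (crease_loop u)] ++
    (map (copy_arr i) t2 ++ s2).
  by rewrite ew et !map_cat -!catA.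
have [x [q [y [h _ eq _]]]] := @split3 QR w _ _ _ ew.
case: (ns q); first by exists x, y.
by exists u, i.
Qed.

(** The path w is eta q' chi_p r' eta, where p is r' eta q'.  The commutativity
    relation at the vertex of eta moves the last loop to the front, where the crease
    relation removes the square. *)
Lemma overlap_full q (p : maxpath T) r i w u (r' q' : seq (arr Q)) :
  around q p r i w -> parr r = rcons r' (crease_loop u) ->
  parr q = crease_loop u :: q' -> parr p = r' ++ crease_loop u :: q' ->
  exists y : pathalg K QR, (forall x, x \in msupp y -> full_subpath x) /\
    ideal_gen (@rep_crease_rels K T `|` @rep_comm_rels K T)%classic (pbasis K w - y).
Proof.
move=> hw er eq ep; have [tq sr] := around_ends hw.
pose e : qpath Q := arrow_path (crease_loop u).
have [r0 [e0 [hr ar ae0]]] : exists r0 e0, [/\ is_cat r0 e0 r, parr r0 = r'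
    & parr e0 = [:: crease_loop u]] by apply: split2; rewrite er cats1.
have [e1 [q0 [hq ae1 aq]]] : exists e1 q0, [/\ is_cat e1 q0 q,
    parr e1 = [:: crease_loop u] & parr q0 = q'] by apply: split2; rewrite eq.
have loop_path f : parr f = [:: crease_loop u] -> f = e.
  by move=> af; apply: qpath_eq_tgt; rewrite // ptgt_parr af.
have ? := loop_path _ ae0; have ? := loop_path _ ae1; subst e0 e1.
have /pcatP[tr0 sr0 _] := hr; have /pcatP[te sq0 _] := hq.
have tq0 := ptgt_cat hq; rewrite /= in sq0.
have [w1 h1] : exists w1, around q p r0 i w1 by apply: around_ex; rewrite -?sr0.
have [w2 h2] : exists w2, around q0 p r i w2 by apply: around_ex; rewrite -?tq0.
have [w3 h3] : exists w3, around q0 p r0 i w3 by apply: around_ex; rewrite -?tq0 -?sr0.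
pose s : qpath Q := stationary (crease_vertex u).
have ep1 : is_cat3 r0 s q p.
  by apply/is_cat3P; split; rewrite ?ar ?eq //= -?sr0.
have ep2 : is_cat3 r s q0 p.
  by apply/is_cat3P; split; rewrite ?er ?aq ?(ptgt_rcons er) ?cat_rcons.
have [m hm] : exists m, is_cat3 r0 e q0 m by apply: is_cat3_ex.
have ep3 : is_cat3 r0 e q0 p.
  by apply/is_cat3P; split; rewrite ?ar ?aq //= -sr0.
exists (lam1 T u *: pbasis K w1 + lam2 T u *: pbasis K w3); split.
  move=> x /(fsubsetP (msuppD_le _ _)); rewrite in_fsetU => /orP[]
    /(fsubsetP (msuppZ_le _ _))/(fsubsetP msuppU_le); rewrite inE => /eqP->.
    exact: around_full h1 ep1.
  exact: around_full h3 ep3.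
have sw2 : psrc w2 = (psrc q0, i) by have /is_cat3P[_ _ -> _] := h2.
have sw3 : psrc w3 = (psrc q0, i) by have /is_cat3P[_ _ -> _] := h3.
have c2 : is_cat (copy i e) w2 w.
  apply/pcatP; rewrite ptgt_copy te sw2; split=> //.
    by have /is_cat3P[_ _ -> _] := hw; rewrite /psrc /= -!/(psrc _) sq0.
  by rewrite (around_parr hw) (around_parr h2) eq aq.
have c3 : is_cat (copy i e) w3 w1.
  apply/pcatP; rewrite ptgt_copy te sw3; split=> //.
    by have /is_cat3P[_ _ -> _] := h1; rewrite /psrc /= -!/(psrc _) sq0.
  by rewrite (around_parr h1) (around_parr h3) eq aq.
apply: (@overlap_combination K (pathalg K QR) _
  (pbasis K (arrow_path (copy_arr i (crease_loop u)))) (pbasis K (copy i s))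
  _ _ (pbasis K w2) _ _ _ (ideal_gen_ideal _)).
- exact: etrans (pbasis_cat K c2) (f_equal (fun x => pbasis K x ** _) (copy_arrow i _)).
- exact: etrans (pbasis_cat K c3) (f_equal (fun x => pbasis K x ** _) (copy_arrow i _)).
- by apply: esym; apply: pbasis_cat; apply/pcatP; rewrite ptgt_copy sw3 -te.
- by apply: ideal_genS; right; exists p, p, r0, r, s, q, q0, i, w1, w2.
- by apply: ideal_genS; left; exists u, i.
Qed.

(** If q p^* r is not 0 then q chi_p r is a subpath of a full path, unless q and r
    overlap in a crease loop; in that case it reduces to subpaths of full paths. *)
Lemma rep_hom_zero_path w : zero_path w -> rep_hom (pbasis K w) = 0.
Proof.
move=> [hc ns nf]; case: (rep_path_cases w) => [[i [q ew]]|[q [p [r [i hw]]]]|[_ ->//]].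
  by move: hc; rewrite ew copy_nconnecting.
suff -> : rep_hom (pbasis K w) = rep_inD i 0 by exact: linear0.
apply: etrans (rep_hom_around hw) _; congr rep_inD.
have sp := maxpath_saturated hT p.
have ew := around_parr hw; have [tq sr] := around_ends hw.
have tmq : tame (parr q) by apply: (@no_square_tame i q w [::] _ ns ew).
have tmr : tame (parr r).
  by apply: (@no_square_tame (i - 1) r w (_ ++ [:: chi p i]) [::] ns);
    rewrite cats0 ew -catA.
apply: dual_quot_ext => b; apply: etrans (pairingE _ _ _ _) _.
apply/eqP; apply: contraPT nf => nz; apply.
have [[m hm]|] := top_form_neq0 sp tmq tmr nz.
  exists (pbasis K w); split; last exact: ideal_gen_subrr.
  move=> w' /(fsubsetP msuppU_le); rewrite inE => /eqP->.
  exact: around_full hw hm.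
move=> [u [r' [q' [er eq ep _ _]]]].
apply: (overlap_full hw er eq ep).
Qed.

End Phi.

(** * The relations of Q_R hold in the repetitive algebra *)

Section Families.
Variables (K : fieldType) (A : nualgType K) (V : lmodType K).
Variable F : int -> (A * dual A)%type -> V.
Hypothesis F_linear : forall i, linear (F i).

Definition rep_sum (x : repalg A) : V := \sum_(i <- msupp x) F i x@_i.

Lemma rep_sum_widen (x : repalg A) (d : {fset int}) :
  (msupp x `<=` d)%fset -> rep_sum x = \sum_(i <- d) F i x@_i.
Proof.
move=> le; rewrite /rep_sum (big_fset_incl _ le) //= => i _ /mcoeff_outdom ->.
by have := F_linear i (-1) 0 0; rewrite scaler0 addr0 scaleN1r addNr.
Qed.

Lemma rep_sum_linear : linear rep_sum.
Proof.
move=> c x y; pose d := (msupp x `|` msupp y `|` msupp (c *: x + y))%fset.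
rewrite !(@rep_sum_widen _ d).
- rewrite scaler_sumr -big_split /=; apply: eq_bigr => i _.
  by rewrite -F_linear mcoeffD [(c *: x)@_i]rep_scaleE.
- by rewrite /d -fsetUA fsetUCA fsubsetUl.
- by rewrite /d -fsetUA fsubsetUl.
- by rewrite /d fsubsetUr.
Qed.

Lemma rep_sumU i a f : rep_sum << (a, f) *g i >> = F i (a, f).
Proof. by rewrite (@rep_sum_widen _ [fset i]%fset) ?msuppU_le // big_seq_fset1 mcoeffUU. Qed.

End Families.

Lemma repalgE (K : fieldType) (A : nualgType K) (x : repalg A) :
  x = \sum_(i <- msupp x) (rep_inA i (x@_i).1 + rep_inD i (x@_i).2).
Proof.
rewrite {1}[x]monalgE; apply: eq_bigr => i _; apply/malgP => k.
rewrite mcoeffD rep_inAE rep_inDE mcoeffU eq_sym; case: (k == i) => //=.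
  by rewrite -[RHS]/(_ + 0, 0 + _) addr0 add0r; case: (x@_i).
by rewrite addr0.
Qed.

Section Reduced.
Variables (K : fieldType) (T : folded_triple K).
Hypothesis hT : folded_gentle T.
Local Notation Q := (fquiver T).
Local Notation A := (folded_algebra T).
Local Notation cls x := (quot_proj (relations T) x).

(** The reduced paths span A: ordinary relations vanish and crease relations shorten
    squares of loops. *)
Lemma reduced_dual_ext (f g : dual A) :
  (forall m, sorted (@follows K T) (parr m) -> f (cls (pbasis K m)) = g (cls (pbasis K m))) ->
  f = g.
Proof.
move=> fg; apply: dual_quot_ext => w.
have [k] := ubnP (size (parr w)); elim: k w => // k IH w lew.
have [/(reduced_sorted hT) red|nred] := pselect (reduced_path w); first exact: fg.
have [q [hq [zq|[u eq]]]] : exists q, subpath q w /\ (ord_rel T q \/ crease_square q).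
  apply: contrapT => h; apply: nred => q hq; split=> hq'; apply: h; exists q; split=> //.
    by left.
  by right.
- have -> : cls (pbasis K w) = 0; last by rewrite !dual_f0.
  have [y [z hw]] := hq; apply/quot_proj_eq0.
  have [_ _ Il Ir] := ideal_gen_ideal (relations T).
  have I : ideal_gen (relations T) (pbasis K y ** pbasis K q ** pbasis K z).
    by apply: Ir; apply: Il; apply: ideal_genS; left; exists q.
  by have := pbasis_cat3 K hw => ->.
have [w1 [w2 [y [z [s1 s2 E]]]]] :=
  @loop_square_reduce Q K (crease_loop u : arr Q) (lam1 T u) (lam2 T u) q w erefl eq hq.
have I : ideal_gen (relations T)
    (pbasis K w - lam1 T u *: pbasis K w1 - lam2 T u *: pbasis K w2).
  rewrite E; have [_ _ Il Ir] := ideal_gen_ideal (relations T).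
  by apply: Ir; apply: Il; apply: ideal_genS; right; exists u.
have {}I := quot_proj_combination I.
apply: etrans (dual_combination f I) (etrans _ (esym (dual_combination g I))).
apply: (f_equal2 (fun x y => lam1 T u * x + lam2 T u * y)); apply: IH.
  exact: leq_trans s1 lew.
exact: leq_trans s2 lew.
Qed.

Variable delta : maxpath T -> dual A.
Hypothesis deltaE : forall p x, delta p (cls x) = top_form p x.
Local Notation rep_hom := (rep_hom delta).
Local Notation pairing := (pairing delta).

Lemma rep_hom_copy_hom i x : rep_hom (copy_hom T i x) = rep_inA i (cls x).
Proof.
apply: (eq_linear_pbasis (F := rep_hom \o copy_hom T i)
  (G := rep_inA i \o quot_proj (relations T))) x => [||p].
- exact: linearP.
- exact: linearP.
exact: etrans (f_equal rep_hom (copy_hom_basis i p)) (rep_hom_copy deltaE i p).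
Qed.

Lemma rep_hom_relations x : ideal_gen (rep_relations T) x -> rep_hom x = 0.
Proof.
move=> Ix; suff : (rep_hom @^-1` [set 0])%classic x by [].
apply: Ix.
  by apply: ideal_preim; [apply: (rep_homM deltaE)|apply: ideal_zero].
have cls0 z : relations T z -> cls z = 0.
  by move=> hz; apply/quot_proj_eq0; apply: ideal_genS.
move=> x' [[[[z [i [hz ->]]]|[u [i ->]]]|]|[w hw <-]] /=.
- apply: etrans (rep_hom_copy deltaE i z) _; rewrite cls0 ?linear0 //.
  by left; exists z.
- apply: etrans (f_equal rep_hom (esym (copy_hom_crease u i))) _.
  apply: etrans (rep_hom_copy_hom _ _) _; rewrite cls0 ?linear0 //.
  by right; exists u.
- move=> [p [q [p1 [q1 [m [p3 [q3 [i [w [w' [hp hq hw hw' ->]]]]]]]]]]].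
  apply: etrans (linearB rep_hom _ _) _; apply/eqP; rewrite subr_eq0; apply/eqP.
  apply: etrans (rep_hom_around deltaE hw) (esym (etrans (rep_hom_around deltaE hw') _)).
  apply: (f_equal (rep_inD i)); apply: dual_quot_ext => b.
  apply: etrans (pairingE deltaE _ _ _ _) (etrans _ (esym (pairingE deltaE _ _ _ _))).
  exact: (top_form_comm hT b hq hp).
- exact: (rep_hom_zero_path hT deltaE hw).
Qed.

End Reduced.

(** * The inverse map *)

Section Inverse.
Variables (K : fieldType) (T : folded_triple K).
Hypothesis hT : folded_gentle T.
Local Notation Q := (fquiver T).
Local Notation QR := (rquiver T).
Local Notation A := (folded_algebra T).
Local Notation B := (quotalg (rep_relations T)).
Local Notation cls x := (quot_proj (relations T) x).
Local Notation proj x := (quot_proj (rep_relations T) x).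
Variable delta : maxpath T -> dual A.
Hypothesis deltaE : forall p x, delta p (cls x) = top_form p x.
Local Notation rep_hom := (rep_hom delta).
Local Notation pairing := (pairing delta).

(** The reduced paths m k come with a decomposition p1 (m k) p3 of a maximal path p;
    then g k is p3 p^* p1, and W k i is the path p3 chi_p p1 between the levels i
    and i - 1, which will span DA in the quotient. *)
Variables (n : nat) (m : 'I_n -> qpath Q) (W : 'I_n -> int -> qpath QR).
Variable g : 'I_n -> dual A.
Hypothesis m_inj : injective m.
Hypothesis m_surj : forall p, sorted (@follows K T) (parr p) -> exists k, p = m k.
Hypothesis m_size : forall k j : 'I_n, (k < j)%N ->
  (size (parr (m j)) <= size (parr (m k)))%N.
Hypothesis m_decomp : forall k, exists (p : maxpath T) p1 p3,
  [/\ is_cat3 p1 (m k) p3 p, forall i, around p3 p p1 i (W k i) & g k = pairing p p1 p3].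

Definition gram : 'M[K]_n := \matrix_(k, j) g k (cls (pbasis K (m j))).

(** The path p1 (m j) p3 is then not longer than p, so that [coef_size] applies. *)
Lemma gramE k j : (size (parr (m j)) <= size (parr (m k)))%N -> gram k j = (k == j)%:R.
Proof.
move=> le; rewrite mxE; have [p [p1 [p3 [hp _ ->]]]] := m_decomp k.
apply: etrans (pairingE deltaE _ _ _ _) _.
have /is_cat3P[e1 e2 e3 e4] := hp.
have [[w hw E]|[nc E]] := pbasis_mul3 K p1 (m j) p3; last first.
  apply: etrans (f_equal (top_form p) E) (etrans (linear0 (top_form p)) _).
  by case: eqP => // ekj; case: nc; rewrite -ekj.
apply: etrans (f_equal (top_form p) E) (etrans (top_form_basis p w) _).
have /is_cat3P[f1 f2 f3 f4] := hw.
rewrite /top_coef f3 e3 (is_cat3_tgt hw) (is_cat3_tgt hp) !eqxx /= coef_size; last first.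
  by rewrite f4 e4 !size_cat leq_add2l leq_add2r.
rewrite f4 e4; congr (_ %:R); congr nat_of_bool.
apply/eqP/eqP => [e|->//]; apply: esym; apply: m_inj; apply: qpath_eq.
  by rewrite -f1 -e1.
move/eqP: e; rewrite eqseq_cat // eqxx /= => /eqP e.
have sz : size (parr (m j)) = size (parr (m k)).
  by apply/eqP; rewrite -(eqn_add2r (size (parr p3))) -!size_cat e.
by move/eqP: e; rewrite eqseq_cat // => /andP[/eqP].
Qed.

Lemma gram_unit : gram \in unitmx.
Proof.
rewrite unitmxE det_trig ?unitfE; last first.
  apply/is_trig_mxP => i j lt; rewrite gramE ?m_size //.
  by move: lt; rewrite ltn_neqAle => /andP[/negPf ne _]; rewrite -val_eqE /= ne.
by rewrite prodf_seq_neq0; apply/allP => i _; rewrite gramE // eqxx oner_neq0.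
Qed.

(** The coordinates of a form in the g k, which are a basis of DA. *)
Definition coords (f : dual A) : 'rV[K]_n :=
  (\row_j f (cls (pbasis K (m j)))) *m invmx gram.

Lemma coords_linear : linear coords.
Proof.
move=> c f h; rewrite /coords scalemxAl -mulmxDl; congr (_ *m _).
by apply/rowP => j; rewrite !mxE.
Qed.

Lemma coords_sum f : \sum_k coords f 0 k *: g k = f.
Proof.
apply: (reduced_dual_ext hT) => p /m_surj[j ->].
rewrite dual_sumE.
have : (coords f *m gram) 0 j = f (cls (pbasis K (m j))).
  by rewrite /coords mulmxKV ?gram_unit // mxE.
by rewrite mxE => <-; apply: eq_bigr => k _; rewrite [gram k j]mxE.
Qed.

Lemma coords_g k : coords (g k) = delta_mx 0 k.
Proof.
rewrite /coords -[RHS](mulmxK gram_unit) -rowE; congr (_ *m _).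
by apply/rowP => j; rewrite !mxE.
Qed.

Definition inv_A i (a : A) : B := proj (copy_hom T i (quot_repr a)).

Definition inv_D i (f : dual A) : B := \sum_k coords f 0 k *: proj (pbasis K (W k i)).

Definition inv_component i (x : A * dual A) : B := inv_A i x.1 + inv_D i x.2.

Lemma copy_quot0 i x : ideal_gen (relations T) x ->
  (quot_proj (rep_relations T) \o copy_hom T i) x = 0.
Proof. by move=> Ix; apply/quot_proj_eq0; apply: copy_ideal. Qed.

Lemma inv_AE i x : inv_A i (cls x) = proj (copy_hom T i x).
Proof. exact: (quot_liftE (@copy_quot0 i)). Qed.

Lemma inv_component_linear i : linear (inv_component i).
Proof.
move=> c x y; rewrite /inv_component scalerDr addrACA; congr (_ + _).
  exact: (quot_lift_linear (@copy_quot0 i)).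
rewrite /inv_D /= coords_linear scaler_sumr -big_split /=.
by apply: eq_bigr => k _; rewrite !mxE scalerDl scalerA.
Qed.

(** The isomorphism: on the copies of A it is induced by the copies of Q, on the
    copies of DA it sends g k to the class of W k i. *)
Definition rep_inv : repalg A -> B := rep_sum inv_component.

Lemma rep_inv_linear : linear rep_inv.
Proof. exact: rep_sum_linear inv_component_linear. Qed.

HB.instance Definition _ := GRing.isLinear.Build K (repalg A) B *:%R rep_inv rep_inv_linear.

Lemma rep_inv_A i x : rep_inv (rep_inA i (cls x)) = proj (copy_hom T i x).
Proof.
apply: etrans (rep_sumU inv_component_linear _ _ _) _; rewrite /inv_component /=.
rewrite inv_AE /inv_D big1 ?addr0 // => k _.
by rewrite /coords (_ : \row__ _ = 0) ?mul0mx ?mxE ?scale0r //; apply/rowP => j; rewrite !mxE.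
Qed.

Lemma rep_inv_D k i : rep_inv (rep_inD i (g k)) = proj (pbasis K (W k i)).
Proof.
apply: etrans (rep_sumU inv_component_linear _ _ _) _; rewrite /inv_component /=.
rewrite -[0](linear0 (quot_proj (relations T))) inv_AE !linear0 add0r /inv_D coords_g.
rewrite (bigD1 k) //= big1 ?addr0; first by rewrite mxE !eqxx scale1r.
by move=> j /negPf jk; rewrite mxE eqxx jk scale0r.
Qed.

Definition rep_map (u : B) : repalg A := rep_hom (quot_repr u).

Lemma rep_mapE x : rep_map (proj x) = rep_hom x.
Proof. exact: (quot_liftE (rep_hom_relations hT deltaE)). Qed.

Lemma rep_map_linear : linear rep_map.
Proof. exact: (quot_lift_linear (rep_hom_relations hT deltaE)). Qed.

HB.instance Definition _ := GRing.isLinear.Build K B (repalg A) *:%R rep_map rep_map_linear.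

Lemma rep_mapM : {morph rep_map : u v / u ** v}.
Proof.
move=> u v; rewrite -[u]quot_reprK -[v]quot_reprK.
apply: etrans (f_equal rep_map (esym (quot_projM _ _ _))) _.
apply: etrans (rep_mapE _) _; apply: etrans (rep_homM deltaE _ _) _.
by congr (_ ** _); apply: esym; apply: rep_mapE.
Qed.

Lemma rep_invK : cancel rep_inv rep_map.
Proof.
move=> x; rewrite [RHS]repalgE /rep_inv /rep_sum linear_sum; apply: eq_bigr => i _.
rewrite /inv_component linearD; congr (_ + _).
  rewrite -[(x@_i).1]quot_reprK inv_AE.
  by apply: etrans (rep_mapE _) _; apply: rep_hom_copy_hom.
rewrite -[in RHS](coords_sum (x@_i).2) /inv_D !linear_sum; apply: eq_bigr => k _.
rewrite !linearZ; congr (_ *: _); apply: etrans (rep_mapE _) _.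
have [p [p1 [p3 [_ hW ->]]]] := m_decomp k.
exact: (rep_hom_around deltaE (hW i)).
Qed.

Definition in_image (x : pathalg K QR) : Prop := exists y, rep_inv y = proj x.

Lemma in_image_mod x y z c d :
  ideal_gen (rep_relations T) (x - c *: y - d *: z) -> in_image y -> in_image z ->
  in_image x.
Proof.
move=> I [y' ey] [z' ez]; exists (c *: y' + d *: z').
rewrite (quot_proj_combination I) -ey -ez.
by rewrite linearD (linearZ_LR rep_inv c) (linearZ_LR rep_inv d).
Qed.

Lemma in_image_ideal x : ideal_gen (rep_relations T) x -> in_image x.
Proof. by move=> /quot_proj_eq0 e; exists 0; rewrite linear0 e. Qed.

Lemma in_image_mod1 x y : ideal_gen (rep_relations T) (x - y) -> in_image y -> in_image x.
Proof.
move=> /quot_proj_eq0; rewrite linearB => /eqP; rewrite subr_eq0 => /eqP e [y' ey].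
by exists y'; rewrite e.
Qed.

Lemma in_image_sum (y : pathalg K QR) :
  (forall q, q \in msupp y -> in_image (pbasis K q)) -> in_image y.
Proof.
move=> h; rewrite [y]pathalgE (lin_ext_widen _ (fsubset_refl _)).
rewrite big_seq; apply: (big_ind in_image).
- by apply: in_image_ideal; case: (ideal_gen_ideal (rep_relations T)).
- by move=> a b [a' ea] [b' eb]; exists (a' + b');
  apply: (image_add ea eb).
- by move=> q /h[q' eq]; exists (y@_q *: q');
  apply: (image_scale _ eq).
Qed.

Lemma in_image_copy i p : in_image (pbasis K (copy i p)).
Proof.
exists (rep_inA i (cls (pbasis K p))); apply: etrans (rep_inv_A _ _) _.
by rewrite copy_hom_basis.
Qed.

(** By the commutativity relations it does not matter which decomposition of a
    maximal path a subpath of a full path comes from. *)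
Lemma in_image_full w : full_subpath w -> in_image (pbasis K w).
Proof.
move=> /(full_subpath_cases deltaE)[[i [q ->]]|[p3 [p [p1 [i [m0 [hw hp]]]]]]].
  exact: in_image_copy.
have /m_surj[k ek] : sorted (@follows K T) (parr m0).
  have [+ _ _] := maxpath_saturated hT p; have /is_cat3P[_ _ _ ->] := hp.
  by move=> /cat_sorted2[_ /cat_sorted2[]].
rewrite ek in hp; have [q [q1 [q3 [hq hW eg]]]] := m_decomp k.
apply: (@in_image_mod1 _ (pbasis K (W k i))).
  by apply: ideal_genS; left; right; exists p, q, p1, q1, (m k), p3, q3, i, w, (W k i).
by exists (rep_inD i (g k)); apply: rep_inv_D.
Qed.

(** Squares of crease loops are reduced first.  A path without them that contains a
    connecting arrow is then either among the zero relations or a combination of subpaths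
    of full paths. *)
Lemma in_image_path w : in_image (pbasis K w).
Proof.
have [k] := ubnP (size (parr w)); elim: k w => // k IH w lew.
have [[q [hq [u [i eq]]]]|nsq] := pselect (exists q, subpath q w /\ rep_crease_square q).
  have [w1 [w2 [y [z [s1 s2 E]]]]] :=
    @loop_square_reduce QR K (copy_arr i (crease_loop u)) (lam1 T u) (lam2 T u) q w
      erefl eq hq.
  apply: (@in_image_mod _ (pbasis K w1) (pbasis K w2) (lam1 T u) (lam2 T u)).
  - rewrite E; have [_ _ Il Ir] := ideal_gen_ideal (rep_relations T).
    apply: Ir; apply: Il; apply: ideal_genS; left; left; right; exists u, i.
    by rewrite /rep_crease_rel copy_stationary.
  - by apply: IH; apply: leq_trans s1 lew.
  - by apply: IH; apply: leq_trans s2 lew.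
have [hc|nc] := boolP (has (@is_connecting K T) (parr w)).
  have [[y [hy Iy]]|ny] := pselect (exists y : pathalg K QR,
      (forall q, q \in msupp y -> full_subpath q) /\
      ideal_gen (@rep_crease_rels K T `|` @rep_comm_rels K T)%classic (pbasis K w - y)).
    apply: (@in_image_mod1 _ y).
      apply: ideal_gen_mono Iy => x [hx|hx]; left; last by right.
      by left; right.
    by apply: in_image_sum => q /hy; apply: in_image_full.
  apply: in_image_ideal; apply: ideal_genS; right; exists w => //; split=> //.
  by move=> q hq sq; apply: nsq; exists q.
have [[i [q ->]]|[q [p [r [i hw]]]]|[c _]] := rep_path_cases deltaE w.
- exact: in_image_copy.
- by move: nc; rewrite (around_parr hw) has_cat /= orbT.
- by move: nc; rewrite has_count -leqNgt => h; have := leq_trans c h.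
Qed.

Lemma rep_inv_surj u : exists y, rep_inv y = u.
Proof.
rewrite -[u]quot_reprK; apply: in_image_sum => q _; exact: in_image_path.
Qed.

Lemma rep_mapK : cancel rep_map rep_inv.
Proof. by move=> u; have [y <-] := rep_inv_surj u; rewrite rep_invK. Qed.

Lemma repetitive_isomorphic : nualg_isomorphic (repalg A) B.
Proof.
exists rep_inv; split; first exact: rep_inv_linear.
  exact: can2_numul rep_invK rep_mapK rep_mapM.
by exists rep_map; [apply: rep_invK|apply: rep_mapK].
Qed.

End Inverse.

Theorem lemma7p2 (K : fieldType) (T : folded_triple K)
  (hT : folded_gentle T) (hcrease : (0 < #|cvert T|)%N)
  (hfin : finite_dimensional (folded_algebra T)) :
  nualg_isomorphic (repalg (folded_algebra T)) (quotalg (rep_relations T)).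
Proof.
have /boolp.choice[delta deltaE] : forall p : maxpath T, exists d : dual (folded_algebra T),
    forall x, d (quot_proj (relations T) x) = top_form p x.
  by move=> p; apply: (top_form_dual hT); apply: maxpath_saturated.
have [N bd] := reduced_bounded hT hfin.
have [S [uS sS memS]] := reduced_enum bd.
pose m (k : 'I_(size S)) : qpath (fquiver T) := tnth (in_tuple S) k.
have mS k : m k \in S by apply: mem_tnth.
have /boolp.choice[D hD] : forall k, exists D : maxpath T * qpath (fquiver T) * qpath (fquiver T),
    is_cat3 D.1.2 (m k) D.2 D.1.1.
  move=> k; have := mS k; rewrite memS => /(maximal_extension hT bd)[p [p1 [p3 h]]].
  by exists (p, p1, p3).
have /boolp.choice[W hW] : forall ki : 'I_(size S) * int, exists w,
    around (D ki.1).2 (D ki.1).1.1 (D ki.1).1.2 ki.2 w.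
  move=> [k i]; have h := hD k; apply: around_ex; first by rewrite (is_cat3_tgt h).
  by have /is_cat3P[_ _ -> _] := h.
apply: (@repetitive_isomorphic K T hT delta deltaE (size S) m (fun k i => W (k, i))
  (fun k => pairing delta (D k).1.1 (D k).1.2 (D k).2)).
- by move=> k j; rewrite /m !(tnth_nth (stationary (psrc (m k)))) => /eqP;
    rewrite nth_uniq // => /eqP/val_inj.
- move=> p; rewrite -memS => pS.
  have lt : (index p S < size S)%N by rewrite index_mem.
  by exists (Ordinal lt); rewrite /m (tnth_nth p) nth_index.
- move=> k j lt; rewrite /m !(tnth_nth (stationary (psrc (m k)))).
  have tr : transitive (fun p q : qpath (fquiver T) => (size (parr q) <= size (parr p))%N).
    by move=> y x z h1 h2; apply: leq_trans h2 h1.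
  by apply: (sorted_leq_nth tr _ _ sS); rewrite ?inE ?ltn_ord // ltnW.
by move=> k; exists (D k).1.1, (D k).1.2, (D k).2; split=> // i; apply: (hW (k, i)).
Qed.
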